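(* Given $L\in\mathcal{L}$, let $A_1,\ldots,A_m$ be non-negative matrices that define operators on $L$. Define functions $r,N:[1,\infty)\to\mathbb{R}$ by $$r(t)=\left(\rho(A_1^{(t)})\rho(A_2^{(t)})\cdots\rho(A_m^{(t)})\right)^{1/t}\quad\text{and}\quad N(t)=\left(\|A_1^{(t)}\|\,\|A_2^{(t)}\|\cdots\|A_m^{(t)}\|\right)^{1/t}.$$ Then the function $r$ is decreasing on $[1,\infty)$, and $\rho(A_1\circ A_2\circ\cdots\circ A_m)$ is its lower bound on the interval $[1,m]$. Similarly, the function $N$ is decreasing on $[1,\infty)$, and $\|A_1\circ A_2\circ\cdots\circ A_m\|$ is its lower bound on the interval $[1,m]$. If, in addition, $L=l^2(R)$, then $$w(A_1\circ A_2\circ\cdots\circ A_m)\le\left(w(A_1^{(m)})\,w(A_2^{(m)})\cdots w(A_m^{(m)})\right)^{1/m}.$$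
   Context: Let $R$ be either $\{1,\ldots,n\}$ for some $n\in\mathbb{N}$ or $\mathbb{N}$, and let $S(R)$ be the vector lattice of all complex sequences $(x_i)_{i\in R}$. A Banach space $L\subseteq S(R)$ is a Banach sequence space if $x\in S(R)$, $y\in L$ and $|x|\le|y|$ (coordinatewise) imply $x\in L$ and $\|x\|_L\le\|y\|_L$. $\mathcal{L}$ is the collection of all Banach sequence spaces $L$ such that $e_i=\chi_{\{i\}}\in L$ and $\|e_i\|_L=1$ for all $i\in R$. A matrix $A=[a_{ij}]_{i,j\in R}$ (possibly infinite) is non-negative if $a_{ij}\ge0$ for all $i,j\in R$. A non-negative matrix $A$ defines an operator on $L$ if $Ax\in L$ for all $x\in L$, where $(Ax)_i=\sum_{j\in R}a_{ij}x_j$; this operator is automatically bounded, and $A$ is identified with it. $\|A\|$ is the operator norm and $\rho(A)$ the spectral radius. For non-negative matrices, $A\circ B=[a_{ij}b_{ij}]_{i,j\in R}$ is the Hadamard product and $A^{(t)}=[a_{ij}^t]_{i,j\in R}$, $t\ge0$, is the Hadamard power (with $0^0=1$). For $L\in\mathcal{L}$ and $t\ge1$, Hadamard products and Hadamard $t$-th powers of non-negative matrices defining operators on $L$ again define operators on $L$. For a bounded operator $T$ on $l^2(R)$ the numerical radius is $w(T)=\sup\{|\langle Tf,f\rangle|: f\in l^2(R),\ \|f\|_2=1\}$. ''Decreasing'' is meant in the non-strict sense (non-increasing). *)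

(* Defs.v *)
From HB Require Import structures.
From mathcomp Require Import all_boot all_order all_algebra.
From mathcomp Require Import all_classical all_reals all_analysis.
From mathcomp Require Import complex.

Set Implicit Arguments.
Unset Strict Implicit.
Unset Printing Implicit Defensive.

Import Order.TTheory GRing.Theory Num.Theory.
Import numFieldNormedType.Exports.
Local Open Scope classical_set_scope.
Local Open Scope ring_scope.
Local Open Scope complex_scope.

(* Norms over the scalar field R[i] take their values in R[i]; [rnorm] reads
   such a value as a real number. *)
Definition rnorm (R : realType) (V : normedZmodType R[i]) (x : V) : R :=
  complex.Re `|x|.

Section BoundedOperators.
Variables (R : realType) (X : completeNormedModType R[i]).
Implicit Type T : X -> X.

(* The sets whose suprema are taken below are nonempty and bounded for bounded
   linear operators on X != 0; otherwise [sup] may return its default 0. *)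
Definition opnorm T : R :=
  sup [set rnorm (T x) | x in [set x : X | rnorm x <= 1]].

Definition resolvent_set T : set R[i] :=
  [set l | exists S : {linear X -> X}, [/\ continuous S,
     forall x, S (l *: x - T x) = x & forall x, l *: S x - T (S x) = x]].

Definition spectrum T : set R[i] := ~` resolvent_set T.

Definition spectral_radius T : R :=
  sup [set rnorm (l : R[i]) | l in spectrum T].

End BoundedOperators.

(* [FiniteIndex n] stands for {1, ..., n.+1}, so that the index set is never empty;
   [InfiniteIndex] stands for the natural numbers. *)
Inductive index_kind := FiniteIndex of nat | InfiniteIndex.

Definition idx (k : index_kind) : eqType :=
  match k with FiniteIndex n => 'I_n.+1 | InfiniteIndex => nat end.

Definition has_sum (R : realType) (k : index_kind) :
    (idx k -> R[i]^o) -> R[i]^o -> Prop :=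
  match k with
  | FiniteIndex n => fun u s => s = \sum_(j < n.+1) u j
  | InfiniteIndex => fun u s => series u @ \oo --> s
  end.

(* A Banach space of sequences is given as a Banach space together with an
   injective linear map [seq_of] sending a vector to the underlying sequence. *)
Record banach_seq_space (R : realType) (k : index_kind) := BanachSeqSpace {
  bss_space :> completeNormedModType R[i];
  seq_of : {linear bss_space -> (idx k -> R[i]^o)};
  seq_of_inj : injective seq_of;
  bss_ideal : forall (x : idx k -> R[i]^o) (y : bss_space),
    (forall i, `|x i| <= `|seq_of y i|) ->
    exists2 z : bss_space, seq_of z = x & `|z| <= `|y| }.
Arguments seq_of {R k b}.

(* The class written \mathcal{L}. *)
Definition has_unit_basis (R : realType) (k : index_kind)
    (L : banach_seq_space R k) : Prop :=
  forall i : idx k, exists2 e : L,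
    seq_of e = (fun j => (j == i)%:R : R[i]^o) & `|e| = 1.

Definition imatrix (R : realType) (k : index_kind) := idx k -> idx k -> R.

Section Matrices.
Variables (R : realType) (k : index_kind).
Implicit Types (A : imatrix R k) (L : banach_seq_space R k).

Definition nonneg_matrix A := forall i j, 0 <= A i j.

Definition matrix_maps A (x y : idx k -> R[i]^o) : Prop :=
  forall i, has_sum (fun j => (A i j)%:C * x j : R[i]^o) (y i).

Definition defines_operator L A : Prop :=
  forall x : L, exists y : L, matrix_maps A (seq_of x) (seq_of y).

(* The operator x |-> A x; meaningful when [defines_operator L A]. *)
Definition matrix_op L A (x : L) : L :=
  xget 0 [set y : L | matrix_maps A (seq_of x) (seq_of y)].

Definition matrix_norm L A : R := opnorm (@matrix_op L A).
Definition rho L A : R := spectral_radius (@matrix_op L A).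

(* [powR] satisfies 0 `^ 0 = 1. *)
Definition hadamard_pow A (t : R) : imatrix R k := fun i j => A i j `^ t.

Definition hadamard_prod (m : nat) (A : 'I_m -> imatrix R k) : imatrix R k :=
  fun i j => \prod_(p < m) A p i j.

Definition rho_mean L (m : nat) (A : 'I_m -> imatrix R k) (t : R) : R :=
  (\prod_(p < m) rho L (hadamard_pow (A p) t)) `^ t^-1.

Definition norm_mean L (m : nat) (A : 'I_m -> imatrix R k) (t : R) : R :=
  (\prod_(p < m) matrix_norm L (hadamard_pow (A p) t)) `^ t^-1.

(* L = l^2, with the same norm. *)
Definition is_l2 L : Prop :=
  (forall x : idx k -> R[i]^o, range (@seq_of R k L) x <->
     exists s, has_sum (fun i => `|x i| ^+ 2 : R[i]^o) s) /\
  (forall y : L, has_sum (fun i => `|seq_of y i| ^+ 2 : R[i]^o) (`|y| ^+ 2)).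

(* The numerical radius of an operator on L = l^2; s is <T f, f>. *)
Definition numerical_radius L (T : L -> L) : R :=
  sup [set r : R | exists (f : L) (s : R[i]),
    [/\ `|f| = 1,
        has_sum (fun i => seq_of (T f) i * (seq_of f i)^* : R[i]^o) s
      & r = rnorm s]].

Definition matrix_w L A : R := numerical_radius (@matrix_op L A).

End Matrices.

(* Main.v *)
(* Everything reduces to entrywise inequalities between nonnegative matrices.
   Since [|e_i| = 1], the entries of [A] are at most [||A||], so that
   [A^(t) <= ||A||^(t-1) A] and [||A^(t)|| <= ||A||^t]; and the tangent-line form of
   AM-GM bounds a Hadamard geometric mean of matrices by a suitable linear
   combination of them, which handles products for the norm and, through the
   quadratic form at nonnegative vectors, for the numerical radius.

   For the spectral radius, powers of matrices and Gelfand's formula are avoided: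
   if [r > rho(A)] then [r (r - A)^-1] is a bounded nonnegative matrix [s] with
   [s_ii >= 1] and [A s <= r s], and conversely such an [s] gives [rho(A) <= r] by a
   Neumann series.  These certificates are stable under Hadamard powers (by
   superadditivity of [x^t]) and under Hadamard geometric means (by Hoelder's
   inequality).  Positivity of the resolvent for every [r > rho(A)] is obtained by
   descending from large [r]: if it holds at [s] then it holds slightly below [s],
   by a step controlled by the norm of the resolvent. *)
From HB Require Import structures.
Require Import Defs.
From mathcomp Require Import all_boot all_order all_algebra.
From mathcomp Require Import all_classical all_reals all_analysis.
From mathcomp Require Import complex.
From mathcomp Require Import ring lra.

Set Implicit Arguments.
Unset Strict Implicit.
Unset Printing Implicit Defensive.

Import Order.TTheory GRing.Theory Num.Theory.
Import numFieldNormedType.Exports.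
Local Open Scope classical_set_scope.
Local Open Scope ring_scope.
Local Open Scope complex_scope.

(** * Real-valued norms over the complex scalars *)

Section RealComplex.
Variable R : realType.
Implicit Types a b : R.

Lemma real_complexD a b : (a + b)%:C = a%:C + b%:C.
Proof. by rewrite rmorphD. Qed.

Lemma real_complexM a b : (a * b)%:C = a%:C * b%:C.
Proof. by rewrite rmorphM. Qed.

Lemma real_complex_sum I (s : seq I) (F : I -> R) :
  (\sum_(i <- s) F i)%:C = \sum_(i <- s) (F i)%:C.
Proof. by rewrite rmorph_sum. Qed.

Lemma Re_sum I (s : seq I) (F : I -> R[i]) :
  complex.Re (\sum_(i <- s) F i) = \sum_(i <- s) complex.Re (F i).
Proof. by elim/big_rec2: _ => // i z w _ <-; case: (F i) w => [? ?] []. Qed.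

Lemma Im_sum I (s : seq I) (F : I -> R[i]) :
  complex.Im (\sum_(i <- s) F i) = \sum_(i <- s) complex.Im (F i).
Proof. by elim/big_rec2: _ => // i z w _ <-; case: (F i) w => [? ?] []. Qed.

End RealComplex.

Section ComplexNorm.
Variables (R : realType) (V : normedModType R[i]).
Implicit Types (x y : V) (a b : R) (z : R[i]).

Lemma rnormE x : (rnorm x)%:C = `|x|.
Proof. by rewrite /rnorm RRe_real // ger0_real. Qed.

Lemma rnorm_ge0 x : 0 <= rnorm x.
Proof. by rewrite -ler0c rnormE. Qed.

Lemma rnorm0 : rnorm (0 : V) = 0.
Proof. by rewrite /rnorm normr0. Qed.

Lemma rnorm_eq0 x : rnorm x = 0 -> x = 0.
Proof. by move=> x0; apply: normr0_eq0; rewrite -rnormE x0. Qed.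

Lemma rnormN x : rnorm (- x) = rnorm x.
Proof. by rewrite /rnorm normrN. Qed.

Lemma rnormB x y : rnorm (x - y) = rnorm (y - x).
Proof. by rewrite -rnormN opprB. Qed.

Lemma rnormD x y : rnorm (x + y) <= rnorm x + rnorm y.
Proof. by rewrite -lecR real_complexD !rnormE ler_normD. Qed.

Lemma rnorm_sum I (s : seq I) (F : I -> V) :
  rnorm (\sum_(i <- s) F i) <= \sum_(i <- s) rnorm (F i).
Proof.
elim: s => [|i s IH]; first by rewrite !big_nil rnorm0.
by rewrite !big_cons (le_trans (rnormD _ _)) // lerD2l.
Qed.

Lemma rnormZ z x : rnorm (z *: x) = rnorm (z : R[i]^o) * rnorm x.
Proof.
by apply: complexI; rewrite real_complexM !rnormE normrZ.
Qed.

Lemma rnorm_real a : rnorm (a%:C : R[i]^o) = `|a|.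
Proof. by rewrite /rnorm normc_def /= expr0n addr0 sqrtr_sqr. Qed.

Lemma rnormZ_real a x : 0 <= a -> rnorm (a%:C *: x) = a * rnorm x.
Proof. by move=> a0; rewrite rnormZ rnorm_real ger0_norm. Qed.


(** Positive elements of [R[i]] are real, so real tolerances suffice to test convergence. *)
Lemma cvg_rnormP (u : nat -> V) (l : V) :
  u @ \oo --> l <->
  forall e : R, 0 < e -> exists N, forall n, (N <= n)%N -> rnorm (l - u n) < e.
Proof.
split=> [/cvgrPdist_lt ul e e0 | ul].
  have [|N _ HN] := ul e%:C; first by rewrite ltcR.
  by exists N => n /HN /=; rewrite -rnormE ltcR.
apply/cvgrPdist_lt => e e0.
have [a ea] : exists a, e = a%:C by apply/complex_realP/gtr0_real.
move: e0; rewrite ea ltcR => /ul[N HN].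
by exists N => // n /HN /=; rewrite -rnormE ltcR.
Qed.

Lemma cvg_rnorm_unique (u : nat -> V) (l l' : V) :
  u @ \oo --> l -> u @ \oo --> l' -> l = l'.
Proof. by move=> ul ul'; apply: cvg_unique ul ul'. Qed.

Lemma cvg_rnorm_le (u : nat -> V) (l : V) (c : R) :
  u @ \oo --> l -> (forall n, rnorm (u n) <= c) -> rnorm l <= c.
Proof.
move=> /cvg_rnormP ul uc; apply/ler_addgt0Pr => e /ul[N /(_ N (leqnn _)) le].
rewrite -[l](subrK (u N)) (le_trans (rnormD _ _)) // addrC lerD //.
exact: ltW.
Qed.

End ComplexNorm.

Section ComplexModulus.
Variable R : realType.
Implicit Types z w : R[i]^o.

Lemma rnormM z w : rnorm (z * w : R[i]^o) = rnorm z * rnorm w.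
Proof. exact: (rnormZ (V := R[i]^o) z w). Qed.

Lemma rnorm_nneg z : 0 <= z -> rnorm z = complex.Re z.
Proof. by move=> z0; rewrite /rnorm ger0_norm. Qed.

Lemma ReB z w : complex.Re (z - w) = complex.Re z - complex.Re w.
Proof. by case: z w => [? ?] []. Qed.

Lemma rnorm_Re_le z : `|complex.Re z| <= rnorm z.
Proof.
rewrite /rnorm normc_def /= -sqrtr_sqr ler_wsqrtr //.
by rewrite lerDl sqr_ge0.
Qed.

Lemma rnorm_Im_le z : `|complex.Im z| <= rnorm z.
Proof.
rewrite /rnorm normc_def /= -sqrtr_sqr ler_wsqrtr //.
by rewrite lerDr sqr_ge0.
Qed.

Lemma rnorm_le_ReIm z :
  rnorm z <= `|complex.Re z| + `|complex.Im z|.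
Proof.
rewrite /rnorm normc_def /= -ler_sqr ?nnegrE ?addr_ge0 ?sqrtr_ge0 //.
rewrite sqr_sqrtr ?addr_ge0 ?sqr_ge0 // sqrrD !real_normK ?num_real //.
by rewrite lerD2r lerDl mulrn_wge0 // mulr_ge0.
Qed.

End ComplexModulus.

Lemma rnorm_cauchy (R : realType) (X : completeNormedModType R[i])
    (u : nat -> X) :
  (forall e : R, 0 < e -> exists N, forall n p, (N <= n)%N ->
     rnorm (u (n + p)%N - u n) < e) ->
  exists l : X, u @ \oo --> l.
Proof.
move=> uC; exists (lim (u @ \oo)); apply: cauchy_cvg.
apply/cauchy_exP => e e0.
have [a ea] : exists a, e = a%:C by apply/complex_realP/gtr0_real.
move: e0; rewrite ea ltcR => /uC[N HN].
exists (u N); exists N => // n /= Nn.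
rewrite -ball_normE /ball_ /= -rnormE ltcR rnormB.
by have := HN N (n - N)%N (leqnn _); rewrite subnKC.
Qed.

Lemma geometric_cauchy (R : realType) (X : completeNormedModType R[i])
    (u : nat -> X) (c q : R) : 0 <= q -> q < 1 ->
  (forall n, rnorm (u n.+1 - u n) <= c * q ^+ n) ->
  exists l : X, u @ \oo --> l.
Proof.
move=> q0 q1 uq; have q1' : 0 < 1 - q by rewrite subr_gt0.
have c0 : 0 <= c by have := le_trans (rnorm_ge0 _) (uq 0); rewrite expr0 mulr1.
(* Bound on the tail by [c * (q ^+ n + ... + q ^+ (n + p - 1))], kept in closed form so that the
   induction on [p] is pure algebra. *)
have uD n p : rnorm (u (n + p)%N - u n) <= c * q ^+ n * (1 - q ^+ p) / (1 - q).
  elim: p => [|p IH]; first by rewrite addn0 subrr rnorm0 expr0 subrr mulr0 mul0r.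
  rewrite addnS -[u _.+1](subrK (u (n + p)%N)) -addrA (le_trans (rnormD _ _)) //.
  rewrite (le_trans (lerD (uq _) IH)) // exprD exprS.
  rewrite -(ler_pM2r q1') mulrDl !divfK ?lt0r_neq0 //.
  by rewrite le_eqVlt; apply/orP; left; apply/eqP; ring.
apply: rnorm_cauchy => e e0.
have : geometric c q @ \oo --> 0 by apply: cvg_geometric; rewrite ger0_norm.
move=> /cvgr0Pnorm_lt /(_ (e * (1 - q)) (mulr_gt0 e0 q1'))[N _ HN].
exists N => n p /HN /=; rewrite ger0_norm ?mulr_ge0 ?exprn_ge0 // => lt_n.
apply: le_lt_trans (uD n p) _; rewrite ltr_pdivrMr //.
apply: le_lt_trans lt_n; rewrite ler_piMr ?mulr_ge0 ?exprn_ge0 //.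
by rewrite gerBl exprn_ge0.
Qed.

(** * Neumann series and positive resolvents *)

Section BoundedLinear.
Variables (R : realType) (X : completeNormedModType R[i]).
Implicit Types (T S : {linear X -> X}) (x : X) (K q : R).

Lemma continuous_rnorm_bounded S : continuous S ->
  exists2 M : R, 0 < M & forall x, rnorm (S x) <= M * rnorm x.
Proof.
move=> cS; have /linear_boundedP/pinfty_ex_gt0[e e0 He] :
    bounded_near S (nbhs 0) by exact/continuous_linear_bounded/cS.
have [a ea] : exists a, e = a%:C by apply/complex_realP/gtr0_real.
rewrite ea ltcR in e0; exists a => // x.
by rewrite -lecR real_complexM !rnormE -ea.
Qed.

Lemma rnorm_bounded_continuous S K :
  (forall x, rnorm (S x) <= K * rnorm x) -> continuous S.
Proof.
move=> SK; apply: bounded_linear_continuous; apply/linear_boundedP.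
exists K%:C; split; first exact/complex_realP/ex_intro.
move=> z Kz x; rewrite -!rnormE; apply: (@le_trans _ _ (K%:C * (rnorm x)%:C)).
  by rewrite -real_complexM lecR.
by rewrite ler_wpM2r ?ler0c ?rnorm_ge0 // ltW.
Qed.

Lemma bounded_cvg S K (u : nat -> X) (l : X) :
  (forall x, rnorm (S x) <= K * rnorm x) ->
  u @ \oo --> l -> (fun n => S (u n)) @ \oo --> S l.
Proof.
by move=> SK ul; apply: continuous_cvg ul; exact: (rnorm_bounded_continuous SK).
Qed.

(** The hypothesis bounds the iterates rather than [T] itself, since supersolutions only give
    [K * r ^+ n] with [K] possibly above 1. The convergence clause is kept so that closed cones can
    be transported to [S]. *)
Lemma neumann_series T K q : 0 <= q -> q < 1 ->
  (forall n x, rnorm (iter n T x) <= K * q ^+ n * rnorm x) ->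
  exists S : {linear X -> X},
    [/\ forall x, rnorm (S x) <= K / (1 - q) * rnorm x,
        forall x, S (x - T x) = x, forall x, S x - T (S x) = x
      & forall x, (fun n => \sum_(0 <= i < n) iter i T x) @ \oo --> S x].
Proof.
move=> q0 q1 Tq; have q1' : 0 < 1 - q by rewrite subr_gt0.
pose u x n := \sum_(0 <= i < n) iter i T x.
have uS x n : u x n.+1 = u x n + iter n T x by rewrite /u big_nat_recr.
have /choice[S uS_cvg] x : exists l : X, u x @ \oo --> l.
  apply: (@geometric_cauchy _ _ _ (K * rnorm x) q) => // n.
  by rewrite uS addrAC subrr add0r mulrAC.
have TK x : rnorm (T x) <= K * q * rnorm x by have := Tq 1%N x; rewrite expr1.
have iterL n : linear (iter n T).
  by elim: n => // n IH a x y; rewrite !iterS IH linearP.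
have SL : linear S.
  move=> a x y; apply: (@cvg_rnorm_unique _ _ (u (a *: x + y))) => //.
  have -> : u (a *: x + y) = (fun n => a *: u x n + u y n).
    apply/funext => n; rewrite /u scaler_sumr -big_split /=.
    by apply: eq_bigr => i _; rewrite iterL.
  by apply: cvgD; [apply: cvgZr|].
pose SL' := GRing.isLinear.Build _ _ _ _ S SL.
pose SS : {linear X -> X} := HB.pack S SL'.
have STx x : S (T x) = S x - x.
  apply: (@cvg_rnorm_unique _ _ (u (T x))) => //.
  (* The partial sums at [T x] are those at [x] advanced by one index, less the first term [x]. *)
  have -> : u (T x) = (fun n => u x n.+1 - x).
    apply/funext => n; rewrite /u big_nat_recl //= addrAC subrr add0r.
    by apply: eq_bigr => i _; rewrite -iterSr.
  by apply: cvgB; [have := uS_cvg x; rewrite -cvg_shiftS|exact: cvg_cst].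
have TSx x : T (S x) = S x - x.
  apply: (@cvg_rnorm_unique _ _ (fun n => T (u x n))).
    exact: (bounded_cvg TK).
  have -> : (fun n => T (u x n)) = (fun n => u x n.+1 - x).
    apply/funext => n; rewrite /u big_nat_recl //= addrAC subrr add0r.
    by rewrite linear_sum.
  by apply: cvgB; [have := uS_cvg x; rewrite -cvg_shiftS|exact: cvg_cst].
exists SS; split=> // x; rewrite /SS /=.
- apply: (cvg_rnorm_le (uS_cvg x)) => n.
  have -> : K / (1 - q) * rnorm x = K * rnorm x / (1 - q) by rewrite mulrAC.
  have Kx0 : 0 <= K * rnorm x.
    by have := le_trans (rnorm_ge0 _) (Tq 0 x); rewrite mulr1.
  apply: (@le_trans _ _ (K * rnorm x * (1 - q ^+ n) / (1 - q))).
    rewrite ler_pdivlMr //; elim: n => [|n IH].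
      by rewrite /u big_nil rnorm0 mul0r expr0 subrr mulr0.
    rewrite uS (le_trans (ler_wpM2r (ltW q1') (rnormD _ _))) // mulrDl.
    rewrite (le_trans (lerD IH (ler_wpM2r (ltW q1') (Tq n x)))) // exprS.
    by rewrite le_eqVlt; apply/orP; left; apply/eqP; ring.
  by rewrite ler_pM2r ?invr_gt0 // ler_piMr // gerBl exprn_ge0.
- by have /= -> := raddfB SS x (T x); rewrite STx opprB addrC subrK.
- by rewrite TSx opprB addrC subrK.
Qed.

End BoundedLinear.

(** * Resolvents preserving a closed cone *)

Section PositiveResolvent.
Variables (R : realType) (X : completeNormedModType R[i]).
Implicit Types (T S : {linear X -> X}) (x : X) (K q r s : R).

Lemma iter_bound T K n x : (forall x, rnorm (T x) <= K * rnorm x) -> 0 <= K ->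
  rnorm (iter n T x) <= K ^+ n * rnorm x.
Proof.
move=> TK K0; elim: n => [|n IH]; first by rewrite expr0 mul1r.
by rewrite iterS exprS -mulrA (le_trans (TK _)) // ler_wpM2l.
Qed.

(** The closure properties through which positivity passes from an operator to its Neumann
    series. *)
Definition closed_cone (P : set X) :=
  [/\ P 0, forall x y, P x -> P y -> P (x + y),
      forall a x, 0 <= a -> P x -> P (a%:C *: x)
    & forall (u : nat -> X) l, (forall n, P (u n)) -> u @ \oo --> l -> P l].

Definition preserves (P : set X) T := forall x, P x -> P (T x).

(** Factor [l - T] as [l (1 - l^-1 T)] and invert the second factor by a Neumann series. For [l] a
    nonnegative real, [l^-1 T] preserves every closed cone that [T] does, hence so does the sum. *)
Lemma neumann_resolvent T K r (l : R[i]^o) : 0 <= r -> r < rnorm l ->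
  (forall n x, rnorm (iter n T x) <= K * r ^+ n * rnorm x) ->
  exists S,
    [/\ continuous S, forall x, S (l *: x - T x) = x,
        forall x, l *: S x - T (S x) = x
      & forall P s, closed_cone P -> preserves P T -> l = s%:C -> 0 <= s ->
          preserves P S].
Proof.
move=> r0 rl Tr; have l0' : 0 < rnorm l by exact: le_lt_trans rl.
have l0 : l != 0 by apply: contraTneq l0' => ->; rewrite rnorm0 ltxx.
pose T' : {linear X -> X} := l^-1 \*: T.
have T'E n x : iter n T' x = l^-1 ^+ n *: iter n T x.
  elim: n => [|n IH]; first by rewrite scale1r.
  by rewrite iterS IH /= linearZ /= scalerA exprS.
have rV n : rnorm (l^-1 ^+ n : R[i]^o) = (rnorm l)^-1 ^+ n.
  elim: n => [|n IH].
    by have -> : l^-1 ^+ 0 = 1%:C :> R[i]; rewrite ?rnorm_real ?normr1.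
  rewrite !exprS rnormM IH; congr (_ * _).
  apply: (mulfI (lt0r_neq0 l0')); rewrite -rnormM mulfV // mulfV ?lt0r_neq0 //.
  by have -> : 1 = 1%:C :> R[i] by []; rewrite rnorm_real normr1.
have [||n x|N [NK NL NR Ncvg]] := @neumann_series _ _ T' K (r / rnorm l).
- by rewrite divr_ge0 // ltW.
- by rewrite ltr_pdivrMr // mul1r.
- rewrite T'E rnormZ rV exprMn.
  rewrite [leRHS](_ : _ = (rnorm l)^-1 ^+ n * (K * r ^+ n * rnorm x)); last by ring.
  by rewrite ler_wpM2l ?exprn_ge0 ?invr_ge0 // ltW.
exists (l^-1 \*: N); split => [|x|x|P s [P0 PD PZ Pl] PT ls s0 x Px] /=.
- apply: (@rnorm_bounded_continuous _ _ _
    (rnorm (l^-1 : R[i]^o) * (K / (1 - r / rnorm l)))) => x /=.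
  by rewrite rnormZ -mulrA ler_wpM2l ?rnorm_ge0.
- by rewrite -linearZ /= scalerBr scalerA mulVf // scale1r; exact: NL.
- by rewrite scalerA mulfV // scale1r linearZ /= NR.
have lV : l^-1 = (s^-1)%:C by rewrite ls fmorphV.
rewrite lV; apply: (PZ); rewrite ?invr_ge0 //.
apply: (Pl) (Ncvg x) => n; elim: n => [|n IH]; first by rewrite big_nil.
rewrite big_nat_recr //=; apply: (PD) => //; elim: n {IH} => // n IH.
by rewrite iterS /= {1}lV; apply: (PZ) (PT _ IH); rewrite invr_ge0.
Qed.

(* Among the [s >= r] with a positive resolvent take the infimum: it is in the
   resolvent set, hence the resolvents at nearby [s] are uniformly bounded and the
   Neumann series for [(1 - h S)^-1] reaches a point below the infimum. *)
Lemma positive_resolvent P T M r : closed_cone P -> preserves P T ->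
  (forall x, rnorm (T x) <= M * rnorm x) -> 0 < r ->
  (forall s, r <= s -> resolvent_set T s%:C) ->
  exists S K, [/\ 0 <= K, forall x, rnorm (S x) <= K * rnorm x, preserves P S
    & forall x, r%:C *: S x - T (S x) = x].
Proof.
move=> CP PT TM r0 res.
pose pos s := exists S, [/\ continuous S, forall x, S (s%:C *: x - T x) = x,
  forall x, s%:C *: S x - T (S x) = x & preserves P S].
suff [S [/continuous_rnorm_bounded[K K0 SK] SL SR SP]] : pos r.
  by exists S, K; split=> //; exact: ltW.
pose E := [set s | r <= s /\ pos s].
have hE : has_inf E.
  split; last by exists r => s [].
  (* [E] is nonempty: at any point above the norm bound on [T] the Neumann series already gives a
     positive resolvent. *)
  have M0 : 0 <= Num.max 0 M by rewrite le_max lexx.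
  have sM : Num.max 0 M < Num.max r (Num.max 0 M + 1).
    by rewrite lt_max ltrDl ltr01 orbT.
  have s0 : 0 <= Num.max r (Num.max 0 M + 1) by exact: le_trans M0 (ltW sM).
  exists (Num.max r (Num.max 0 M + 1)); split; first by rewrite le_max lexx.
  have [||n x|S [cS SL SR SP]] :=
    @neumann_resolvent T 1 (Num.max 0 M) (Num.max r (Num.max 0 M + 1))%:C => //.
  - by rewrite rnorm_real ger0_norm.
  - rewrite mul1r; apply: iter_bound => // {}x.
    by rewrite (le_trans (TM x)) // ler_wpM2r ?rnorm_ge0 // le_max lexx orbT.
  - by exists S; split=> //; exact: SP.
have r_inf : r <= inf E by apply: lb_le_inf => [|s []] //; case: hE.
have [S0 [/continuous_rnorm_bounded[M0 M00 S0M] S0L S0R]] := res _ r_inf.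
(* With [s] within [d] of the infimum, [(s - inf E) * M0 <= 1/4], which yields the bound [2 * M0] on
   the resolvent at [s]. A step [h <= d] then makes the Neumann ratio of [h S] at most 1/2. *)
pose d := (4 * M0)^-1; have d0 : 0 < d by rewrite invr_gt0 mulr_gt0.
have dM : d * M0 = 4^-1 by rewrite /d invfM mulfVK // lt0r_neq0.
have [s [rs [S [cS SL SR SP]]] s_lt] := inf_adherent d0 hE.
have s_ge : inf E <= s by apply: ge_inf; [case: hE|split=> //; exists S].
have SM x : rnorm (S x) <= 2 * M0 * rnorm x.
  (* The resolvent identity between [s] and [inf E]. *)
  have SE : S x = S0 x - (s - inf E)%:C *: S0 (S x).
    rewrite -linearZ -linearB /= -[LHS]S0L; congr (S0 _).
    by rewrite -{3}(SR x) rmorphB scalerBl opprB addrC [RHS]addrC addrA subrK addrC.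
  have le1 : (s - inf E) * M0 <= 4^-1.
    by rewrite -dM ler_wpM2r ?(ltW M00) // lerBlDl ltW.
  have le2 : rnorm (S x) <= M0 * rnorm x + 4^-1 * rnorm (S x).
    rewrite {1}SE (le_trans (rnormD _ _)) // rnormN rnormZ_real ?subr_ge0 //.
    apply: lerD => //; apply: le_trans (ler_wpM2r (rnorm_ge0 _) le1).
    by rewrite -mulrA ler_wpM2l ?subr_ge0.
  have := rnorm_ge0 (S x); have := mulr_ge0 (ltW M00) (rnorm_ge0 x).
  by rewrite -mulrA; lra.
(* The step is capped at [s - r] so as not to pass below [r]. If the cap is not active, [s - d]
   belongs to [E] and contradicts [s < inf E + d]; hence [s - h = r]. *)
pose h := Num.min (s - r) d.
have h0 : 0 <= h by rewrite le_min subr_ge0 rs ltW.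
have hd : h <= d by rewrite ge_min lexx orbT.
have hM : h * (2 * M0) <= 2^-1 by have := ler_wpM2r (ltW M00) hd; lra.
pose hS : {linear X -> X} := h%:C \*: S.
have hSM x : rnorm (hS x) <= 2^-1 * rnorm x.
  rewrite /hS /= rnormZ_real // (le_trans (ler_wpM2l h0 (SM x))) // mulrA.
  by rewrite ler_wpM2r ?rnorm_ge0.
have [||n x|N [NK NL NR Ncvg]] := @neumann_series _ _ hS 1 2^-1.
- by rewrite invr_ge0.
- by rewrite invf_lt1 ?ltr1n.
- by rewrite mul1r; apply: iter_bound.
have sh : s - h \in E.
  rewrite inE; split; first by rewrite lerBrDl -lerBrDr ge_min lexx.
  (* Since [s - h - T = (1 - h S) (s - T)], its inverse is [S] composed with the inverse [N] of
     [1 - h S]. *)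
  exists (S \o N); split=> [|x|x|x Px] /=.
  - apply: (@rnorm_bounded_continuous _ _ _ (2 * M0 * (1 / (1 - 2^-1)))) => x /=.
    by rewrite (le_trans (SM _)) // -[leRHS]mulrA ler_wpM2l // mulr_ge0 // ltW.
  - rewrite -[X in N X]/(_ - _) rmorphB scalerBl addrAC.
    have /= := NL (s%:C *: x - T x); rewrite SL => NLx.
    exact: etrans (congr1 S NLx) (SL x).
  - by rewrite rmorphB scalerBl addrAC SR; exact: NR.
  - apply: (SP); case: (CP) => P0 PD PZ Pl; apply: (Pl) (Ncvg x) => n.
    elim: n => [|n IH]; first by rewrite big_nil.
    rewrite big_nat_recr //=; apply: (PD) => //; elim: n {IH} => // n IH.
    exact: (PZ) (SP _ IH).
move: sh; rewrite inE => sh; have := ge_inf (proj2 hE) sh.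
case: (leP (s - r) d) => [srd _|srd].
  by move: sh; rewrite /h min_l // subKr => -[].
rewrite /h (min_r (ltW srd)) => le_inf.
by move: s_lt; rewrite ltNge -lerBrDr le_inf.
Qed.

End PositiveResolvent.

(** * Geometric means *)

Section PowerInequalities.
Variable R : realType.
Implicit Types t a b : R.

Lemma powR_le_mul t a b : 1 <= t -> 0 <= a -> a <= b ->
  a `^ t <= b `^ (t - 1) * a.
Proof.
move=> t1 a0 ab; have t0 : 0 < t by exact: lt_le_trans ltr01 t1.
rewrite -mulr_powRB1 // mulrC ler_wpM2r // ge0_ler_powR ?nnegrE ?subr_ge0 //.
exact: le_trans a0 ab.
Qed.

Lemma powR_sum_le t I (s : seq I) (x : I -> R) : 1 <= t ->
  (forall i, 0 <= x i) ->
  \sum_(i <- s) x i `^ t <= (\sum_(i <- s) x i) `^ t.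
Proof.
move=> t1 x0; have t0 : 0 < t by exact: lt_le_trans ltr01 t1.
have xs0 r : 0 <= \sum_(i <- r) x i by exact: sumr_ge0.
elim: s => [|i s IH]; first by rewrite !big_nil powR0 ?lt0r_neq0.
rewrite !big_cons -[leRHS]mulr_powRB1 ?addr_ge0 // mulrDl.
have le_pow a : 0 <= a -> a <= x i + \sum_(j <- s) x j ->
    a `^ t <= a * (x i + \sum_(j <- s) x j) `^ (t - 1).
  by move=> a0 la; rewrite mulrC powR_le_mul.
rewrite lerD ?le_pow ?lerDl // (le_trans IH) // le_pow ?lerDr //.
Qed.

End PowerInequalities.

Section GeometricMean.
Variables (R : realType) (m : nat).
Hypothesis m_gt0 : (0 < m)%N.
Implicit Types x y w : 'I_m -> R.

Definition gmean x : R := (\prod_(p < m) x p) `^ m%:R^-1.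

Let m0 : m%:R != 0 :> R. Proof. by rewrite pnatr_eq0 -lt0n. Qed.
Let mV : 0 < m%:R^-1 :> R. Proof. by rewrite invr_gt0 ltr0n. Qed.

Lemma gmean_ge0 x : 0 <= gmean x.
Proof. exact: powR_ge0. Qed.

Lemma gmean_le x y : (forall p, 0 <= x p) -> (forall p, x p <= y p) ->
  gmean x <= gmean y.
Proof.
move=> x0 xy; apply: ge0_ler_powR; first exact: ltW.
- by rewrite nnegrE prodr_ge0.
- by rewrite nnegrE prodr_ge0 // => p _; exact: le_trans (x0 p) (xy p).
- by apply: ler_prod => p _; rewrite x0 xy.
Qed.

Lemma exprK_powRV (a : R) : 0 <= a -> (a ^+ m) `^ m%:R^-1 = a.
Proof. by move=> a0; rewrite -powR_mulrn // -powRrM mulfV // powRr1. Qed.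

Lemma powRV_exprK (a : R) : 0 <= a -> a `^ m%:R^-1 ^+ m = a.
Proof.
by move=> a0; rewrite -powR_mulrn ?powR_ge0 // -powRrM mulVf // powRr1.
Qed.

Lemma gmeanM x y : (forall p, 0 <= x p) -> (forall p, 0 <= y p) ->
  gmean (fun p => x p * y p) = gmean x * gmean y.
Proof. by move=> x0 y0; rewrite /gmean big_split powRM ?prodr_ge0. Qed.

Lemma gmean_powR x : (forall p, 0 <= x p) ->
  gmean (fun p => x p `^ m%:R) = \prod_(p < m) x p.
Proof.
move=> x0; rewrite -[RHS]exprK_powRV ?prodr_ge0 // -prodrXl /gmean.
by congr (_ `^ _); apply: eq_bigr => p _; rewrite powR_mulrn.
Qed.

(* The linear functional [w] is tangent to the concave function [gmean] at [y]. *)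
Lemma AGM_tangent y : (forall p, 0 < y p) -> exists w,
  [/\ forall p, 0 <= w p, \sum_p w p * y p = gmean y
    & forall x, (forall p, 0 <= x p) -> gmean x <= \sum_p w p * x p].
Proof.
(* The weights are the partial derivatives of [gmean] at [y]. *)
move=> y0; exists (fun p => gmean y / m%:R / y p); split => [p||x x0].
- by rewrite divr_ge0 ?divr_ge0 ?gmean_ge0 ?(ltW (y0 p)).
- rewrite (eq_bigr (fun=> gmean y / m%:R)) => [|p _]; last first.
    by rewrite divfK ?lt0r_neq0.
  by rewrite sumr_const card_ord -[LHS]mulr_natr divfK.
(* Dividing by [y] moves the point of tangency to the all-ones tuple, where the claim is the AM-GM
   inequality. *)
pose z p := x p / y p; have z0 p : 0 <= z p by rewrite divr_ge0 // ltW.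
have -> : gmean x = gmean y * gmean z.
  rewrite -gmeanM //; last by move=> p; exact: ltW.
  by rewrite /gmean; congr (_ `^ _); apply: eq_bigr => p _;
    rewrite mulrC divfK ?lt0r_neq0.
have -> : \sum_p gmean y / m%:R / y p * x p = gmean y * ((\sum_p z p) / m%:R).
  rewrite mulr_suml mulr_sumr; apply: eq_bigr => p _.
  by rewrite -!mulrA; congr (_ * _); rewrite mulrC -mulrA mulrCA mulrA.
apply: ler_wpM2l; first exact: gmean_ge0.
have /= [agm _] := @leif_AGM R 'I_m predT z (fun p _ => z0 p).
have s0 : 0 <= (\sum_p z p) / m%:R by rewrite divr_ge0 ?sumr_ge0.
rewrite -[leRHS](exprK_powRV s0).
apply: ge0_ler_powR; rewrite ?nnegrE ?(ltW mV) ?prodr_ge0 ?exprn_ge0 //.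
by move: agm; rewrite (_ : #|predT| = m) //; exact: card_ord.
Qed.

(** Allows a bound to be proved only against strictly larger, hence strictly positive, tuples, where
    [AGM_tangent] applies even if some [x p] vanishes. *)
Lemma gmean_ge_approx x (v : R) : (forall p, 0 <= x p) ->
  (forall y, (forall p, x p < y p) -> v <= gmean y) -> v <= gmean x.
Proof.
move=> x0 xv; case: (leP v 0) => [v0|v0].
  exact: le_trans v0 (gmean_ge0 _).
(* Passing to [m]-th powers leaves a finite product, whose continuity is enough to let the
   perturbation [harmonic n] tend to 0. *)
rewrite -[leLHS]exprK_powRV ?(ltW v0) //.
apply: ge0_ler_powR; rewrite ?nnegrE ?(ltW mV) ?exprn_ge0 ?prodr_ge0 ?(ltW v0) //.
have xn : (fun n => \prod_(p < m) (x p + harmonic n)) @ \oo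
    --> \prod_(p < m) x p.
  apply: cvg_big => [|p _]; first exact: mul_continuous.
  by rewrite -[X in _ --> X]addr0; apply: cvgD;
    [exact: cvg_cst|exact: cvg_harmonic].
apply: cvgr_to_ge xn _; near=> n.
have h0 : 0 < harmonic n :> R by rewrite invr_gt0.
have xh p : x p < x p + harmonic n by rewrite ltrDl.
have prod0 : 0 <= \prod_(p < m) (x p + harmonic n).
  by apply: prodr_ge0 => p _; exact: le_trans (x0 p) (ltW (xh p)).
rewrite -[leRHS](powRV_exprK prod0).
by rewrite lerXn2r ?nnegrE ?gmean_ge0 ?(ltW v0) // xv.
Unshelve. all: by end_near. Qed.

(** A tangent functional of [gmean] is linear, so it commutes with the sum over [s] while dominating
    [gmean] at each index. *)
Lemma hoelder_gmean I (s : seq I) (u : 'I_m -> I -> R) :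
  (forall p i, 0 <= u p i) ->
  \sum_(i <- s) gmean (u^~ i) <= gmean (fun p => \sum_(i <- s) u p i).
Proof.
move=> u0; apply: gmean_ge_approx => [p|y uy]; first exact: sumr_ge0.
have y0 p : 0 < y p by apply: le_lt_trans (uy p); exact: sumr_ge0.
have [w [w0 <- wle]] := AGM_tangent y0.
apply: (@le_trans _ _ (\sum_(i <- s) \sum_p w p * u p i)).
  by apply: ler_sum => i _; exact: wle.
rewrite exchange_big /=; apply: ler_sum => p _.
by rewrite -mulr_sumr ler_wpM2l // ltW.
Qed.

End GeometricMean.

(** * Sums over the index set *)

Section IndexSums.
Variables (R : realType) (k : index_kind).

(* Finite sections exhausting the index set: [has_sum] is convergence along them
   for both kinds of index sets. *)
Definition sec (n : nat) : seq (idx k) :=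
  match k return seq (idx k) with
  | FiniteIndex n0 => enum 'I_n0.+1
  | InfiniteIndex => iota 0 n
  end.

Lemma sec_uniq n : uniq (sec n).
Proof. by rewrite /sec; case: k => [p|]; [exact: enum_uniq|exact: iota_uniq]. Qed.

Lemma sec_prefix n p : (n <= p)%N -> exists s, sec p = sec n ++ s.
Proof.
rewrite /sec; case: k => [q _|np]; first by exists [::]; rewrite cats0.
by exists (iota n (p - n)); rewrite -[X in iota X (p - n)]add0n -iotaD subnKC.
Qed.

Lemma mem_sec (i : idx k) : exists N, forall n, (N <= n)%N -> i \in sec n.
Proof.
rewrite /sec; case: k i => [p i|i]; first by exists 0%N => n _; rewrite mem_enum.
by exists i.+1 => n ni; rewrite mem_iota add0n.
Qed.

Definition psum (V : nmodType) (u : idx k -> V) n := \sum_(j <- sec n) u j.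

Lemma has_sumE (u : idx k -> R[i]^o) (s : R[i]^o) :
  has_sum u s <-> psum u @ \oo --> s.
Proof.
rewrite /has_sum /psum /sec; case: k u => [p u|u].
  rewrite big_enum; split=> [-> |]; first exact: cvg_cst.
  by move=> us; apply: cvg_rnorm_unique us _; exact: cvg_cst.
rewrite [X in X @ \oo --> s <-> _](_ : _ = fun n => \sum_(j <- iota 0 n) u j) //.
by apply/funext => n; rewrite /series /= /index_iota subn0.
Qed.

Lemma has_sum_unique (u : idx k -> R[i]^o) (s t : R[i]^o) :
  has_sum u s -> has_sum u t -> s = t.
Proof. by move=> /has_sumE us /has_sumE; exact: cvg_rnorm_unique. Qed.

Lemma has_sumD (u v : idx k -> R[i]^o) (s t a : R[i]^o) :
  has_sum u s -> has_sum v t ->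
  has_sum (fun j => a * u j + v j : R[i]^o) (a * s + t : R[i]^o).
Proof.
move=> /has_sumE /cvg_rnormP us /has_sumE /cvg_rnormP vt.
apply/has_sumE/cvg_rnormP => e e0.
have e2 : 0 < e / 2 by rewrite divr_gt0.
(* The added 1 keeps the divisor positive when [a = 0]. *)
have a1 : 0 < rnorm a + 1 by rewrite ltr_wpDl ?rnorm_ge0.
have [N HN] := us _ (divr_gt0 e2 a1); have [N' HN'] := vt _ e2.
exists (maxn N N') => n; rewrite geq_max => /andP[/HN us_n /HN' vt_n].
have -> : (a * s + t : R[i]^o) - psum (fun j => a * u j + v j : R[i]^o) n =
    (a * (s - psum u n) : R[i]^o) + (t - psum v n).
  by rewrite /psum big_split /= -mulr_sumr mulrBr addrACA opprD.
rewrite (le_lt_trans (rnormD _ _)) // rnormM [e]splitr ler_ltD //.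
rewrite (le_trans _ (_ : (rnorm a + 1) * rnorm (s - psum u n) <= _)) //.
  by rewrite ler_wpM2r ?rnorm_ge0 // lerDl.
by rewrite mulrC -ler_pdivlMr // ltW.
Qed.

Implicit Types u v : idx k -> R.

Lemma psum_ge0 u n : (forall j, 0 <= u j) -> 0 <= psum u n.
Proof. by move=> u0; exact: sumr_ge0. Qed.

Lemma le_psum u v n : (forall j, u j <= v j) -> psum u n <= psum v n.
Proof. by move=> uv; apply: ler_sum. Qed.

Lemma psum_homo u : (forall j, 0 <= u j) ->
  {homo psum u : n p / (n <= p)%N >-> n <= p}.
Proof.
move=> u0 n p /sec_prefix[s sE].
by rewrite /psum sE big_cat lerDl sumr_ge0.
Qed.

Lemma psum_ge_term u i : (forall j, 0 <= u j) -> exists n, u i <= psum u n.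
Proof.
move=> u0; have [n /(_ n (leqnn n)) i_n] := mem_sec i; exists n.
by rewrite /psum (big_rem i) //= lerDl sumr_ge0.
Qed.

Lemma psum_cvg u c : (forall j, 0 <= u j) -> (forall n, psum u n <= c) ->
  exists l : R, [/\ psum u @ \oo --> l, forall n, psum u n <= l & l <= c].
Proof.
move=> u0 uc; have cv : cvgn (psum u).
  apply: nondecreasing_is_cvgn; first exact: psum_homo.
  by exists c => _ [n _ <-].
exists (limn (psum u)); split=> // [n|].
  by apply: nondecreasing_cvgn_le => //; exact: psum_homo.
by apply: limr_le => //; near=> n.
Unshelve. all: by end_near. Qed.

Lemma cvg_Re (z : nat -> R[i]^o) (l : R[i]^o) : z @ \oo --> l ->
  (fun n => complex.Re (z n)) @ \oo --> complex.Re l.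
Proof.
move=> /cvg_rnormP zl; apply/cvgrPdist_lt => e /zl[N HN].
exists N => // n /HN; apply: le_lt_trans.
by apply: le_trans (rnorm_Re_le _); case: (l) (z n) => [? ?] [].
Qed.

Lemma cvg_complex (z : nat -> R[i]^o) (a b : R) :
  (fun n => complex.Re (z n)) @ \oo --> a ->
  (fun n => complex.Im (z n)) @ \oo --> b -> z @ \oo --> (a +i* b : R[i]^o).
Proof.
move=> /cvgrPdist_lt za /cvgrPdist_lt zb; apply/cvg_rnormP => e e0.
have e2 : 0 < e / 2 by rewrite divr_gt0.
have [N _ HN] := za _ e2; have [N' _ HN'] := zb _ e2.
exists (maxn N N') => n; rewrite geq_max => /andP[/HN /= za_n /HN' /= zb_n].
apply: le_lt_trans (rnorm_le_ReIm _) _; rewrite [e]splitr.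
by move: za_n zb_n; case: (z n) => x y /= za_n zb_n; exact: ltrD.
Qed.

Lemma has_sum_abs (z : idx k -> R[i]^o) v c :
  (forall j, rnorm (z j) <= v j) -> (forall n, psum v n <= c) ->
  exists2 s, has_sum z s & rnorm s <= c.
Proof.
move=> zv vc; have v0 j : 0 <= v j by exact: le_trans (rnorm_ge0 _) (zv j).
have [lv [vl _ _]] := psum_cvg v0 vc.
have cv (f : idx k -> R) : (forall j, `|f j| <= v j) -> exists l : R, psum f @ \oo --> l.
  (* Shifting by [v] makes the terms nonnegative with partial sums at most [c + c], so monotone
     convergence applies; the limit of [psum v] is then subtracted. *)
  move=> fv; have [|n|l [fl _ _]] := @psum_cvg (fun j => f j + v j) (c + c).
  - by move=> j; have := fv j; rewrite ler_norml -lerBlDr sub0r => /andP[].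
  - rewrite /psum big_split lerD //; last exact: vc.
    apply: le_trans (vc n); apply: ler_sum => j _.
    exact: le_trans (ler_norm _) (fv j).
  exists (l - lv).
  have -> : psum f = (fun n => psum (fun j => f j + v j) n - psum v n).
    by apply/funext => n; rewrite /psum big_split addrK.
  exact: cvgB.
have [a za] : exists a : R, psum (fun j => complex.Re (z j)) @ \oo --> a.
  by apply: cv => j; exact: le_trans (rnorm_Re_le _) (zv j).
have [b zb] : exists b : R, psum (fun j => complex.Im (z j)) @ \oo --> b.
  by apply: cv => j; exact: le_trans (rnorm_Im_le _) (zv j).
have z_cvg : psum z @ \oo --> (a +i* b : R[i]^o).
  apply: cvg_complex.
    by under eq_fun do rewrite /psum Re_sum.
  by under eq_fun do rewrite /psum Im_sum.
exists (a +i* b); first exact/has_sumE.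
apply: cvg_rnorm_le z_cvg _ => n; apply: le_trans (vc n).
by apply: le_trans (rnorm_sum _ _) _; exact: ler_sum.
Qed.

Lemma has_sum_real u (s : R[i]^o) :
  has_sum (fun j => (u j)%:C : R[i]^o) s -> psum u @ \oo --> complex.Re s.
Proof.
move=> /has_sumE /cvg_Re.
by under eq_fun do rewrite /psum Re_sum.
Qed.

End IndexSums.

(** * Banach sequence spaces and matrix operators *)

Section SequenceSpace.
Variables (R : realType) (k : index_kind) (L : banach_seq_space R k).
Hypothesis hL : has_unit_basis L.
Implicit Types (x y : L) (f g : idx k -> R) (A B : imatrix R k) (a c d r M : R).

Definition coord x i : R[i]^o := seq_of x i.

Lemma coordD x y i : coord (x + y) i = coord x i + coord y i.
Proof. by rewrite /coord linearD. Qed.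

Lemma coordB x y i : coord (x - y) i = coord x i - coord y i.
Proof. by rewrite /coord linearB. Qed.

Lemma coordZ (z : R[i]^o) x i : coord (z *: x) i = z * coord x i.
Proof. by rewrite /coord linearZ. Qed.

Lemma coord_sum I (s : seq I) (F : I -> L) i :
  coord (\sum_(j <- s) F j) i = \sum_(j <- s) coord (F j) i.
Proof.
elim: s => [|j s IH]; first by rewrite !big_nil /coord linear0.
by rewrite !big_cons coordD IH.
Qed.

Lemma coord_inj x y : (forall i, coord x i = coord y i) -> x = y.
Proof. by move=> xy; apply: seq_of_inj; apply/funext. Qed.

Lemma ideal_rnorm (z : idx k -> R[i]^o) y :
  (forall i, rnorm (z i) <= rnorm (coord y i)) ->
  exists2 x, forall i, coord x i = z i & rnorm x <= rnorm y.
Proof.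
move=> zy; have [i|x xz xy] := @bss_ideal _ _ L z y.
  by rewrite -!rnormE lecR; exact: zy.
by exists x => [i|]; rewrite ?/coord ?xz // -lecR !rnormE.
Qed.

Lemma rnorm_homo x y :
  (forall i, rnorm (coord x i) <= rnorm (coord y i)) -> rnorm x <= rnorm y.
Proof. by move=> /ideal_rnorm[z /coord_inj ->]. Qed.

Lemma unit_vector i : exists2 e : L,
  forall j, coord e j = (j == i)%:R & rnorm e = 1.
Proof.
have [e eE e1] := hL i; exists e => [j|]; first by rewrite /coord eE.
by rewrite /rnorm e1.
Qed.

(** The vector [x_i e_i] lies below [x] in modulus and [e_i] has norm 1. Consequently norm
    convergence implies coordinatewise convergence. *)
Lemma rnorm_coord x i : rnorm (coord x i) <= rnorm x.
Proof.
have [e eE e1] := unit_vector i.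
rewrite -[leLHS]mulr1 -e1 -rnormZ; apply: rnorm_homo => j.
rewrite coordZ eE; case: eqP => [->|_]; first by rewrite mulr1.
by rewrite mulr0 (rnorm0 (R[i]^o)) rnorm_ge0.
Qed.

Lemma cvg_coord (u : nat -> L) (l : L) i : u @ \oo --> l ->
  (fun n => coord (u n) i) @ \oo --> coord l i.
Proof.
move=> /cvg_rnormP ul; apply/cvg_rnormP => e /ul[N HN]; exists N => n /HN.
by apply: le_lt_trans; rewrite -coordB rnorm_coord.
Qed.

Definition nonneg_vec : set L := [set x | forall i, 0 <= coord x i].

Lemma nonneg_vecP x : nonneg_vec x ->
  forall i, 0 <= complex.Re (coord x i) /\ coord x i = (complex.Re (coord x i))%:C.
Proof.
move=> x0 i; have xr := RRe_real (ger0_real (x0 i)); split=> //.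
by have := x0 i; rewrite -xr ler0c.
Qed.

Lemma nonneg_vec_real x f : (forall i, 0 <= f i) ->
  (forall i, coord x i = (f i)%:C) -> nonneg_vec x.
Proof. by move=> f0 xf i; rewrite xf ler0c. Qed.

Lemma nonneg_vec_rnorm x y : nonneg_vec x -> nonneg_vec (y - x) ->
  rnorm x <= rnorm y.
Proof.
move=> x0 yx; apply: rnorm_homo => i.
have yxi : 0 <= complex.Re (coord y i) - complex.Re (coord x i).
  by rewrite -ReB -coordB; exact: (nonneg_vecP yx i).1.
rewrite rnorm_nneg; last exact: x0.
rewrite subr_ge0 in yxi; apply: le_trans yxi _.
exact: le_trans (ler_norm _) (rnorm_Re_le _).
Qed.

Lemma nonneg_vec_cone : closed_cone nonneg_vec.
Proof.
split=> [i|x y x0 y0 i|a x a0 x0 i|u l u0 ul i].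
- by rewrite /coord linear0.
- by rewrite coordD addr_ge0.
- by rewrite coordZ mulr_ge0 // ler0c.
have cl := @cvg_coord u l i ul.
have Im0 : (fun n => complex.Im (coord (u n) i)) = (fun=> 0).
  by apply/funext => n; apply: ger0_Im; exact: u0.
have Re_l : 0 <= complex.Re (coord l i).
  apply: cvgr_to_ge (cvg_Re cl) _; near=> n.
  exact: (nonneg_vecP (u0 n) i).1.
have -> : coord l i = (complex.Re (coord l i))%:C.
  apply: cvg_rnorm_unique cl (cvg_complex (b := 0) (cvg_Re cl) _).
  by rewrite Im0; exact: cvg_cst.
by rewrite ler0c.
Unshelve. all: by end_near. Qed.

(** For nonnegative [f] this says that [f] belongs to [L] with norm at most [c], as [dominatedP]
    shows; the form lets estimates be made on real functions without constructing vectors. *)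
Definition dominated f c :=
  exists2 x, forall i, f i <= rnorm (coord x i) & rnorm x <= c.

Lemma dominated_vec x : dominated (fun i => rnorm (coord x i)) (rnorm x).
Proof. by exists x. Qed.

Lemma dominated_le f g c d : dominated g d -> (forall i, f i <= g i) -> d <= c ->
  dominated f c.
Proof.
move=> [x gx xd] fg dc; exists x => [i|]; first exact: le_trans (fg i) (gx i).
exact: le_trans dc.
Qed.

Lemma dominatedP f c : (forall i, 0 <= f i) -> dominated f c ->
  exists2 x, forall i, coord x i = (f i)%:C & rnorm x <= c.
Proof.
move=> f0 [y fy yc]; have [i|x xf xy] := @ideal_rnorm (fun i => (f i)%:C) y.
  by rewrite rnorm_real ger0_norm.
by exists x => //; exact: le_trans yc.
Qed.

Lemma dominated_coord f c i : dominated f c -> f i <= c.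
Proof.
by move=> [x fx xc]; rewrite (le_trans (fx i)) // (le_trans (rnorm_coord x i)).
Qed.

Lemma dominated_ge0 f c : dominated f c -> 0 <= c.
Proof. by move=> [x _]; apply: le_trans; exact: rnorm_ge0. Qed.

Lemma dominatedZ f c a : 0 <= a -> dominated f c ->
  dominated (fun i => a * f i) (a * c).
Proof.
move=> a0 [x fx xc]; exists (a%:C *: x) => [i|].
  by rewrite coordZ rnormM rnorm_real ger0_norm // ler_wpM2l.
by rewrite rnormZ_real // ler_wpM2l.
Qed.

Lemma dominatedD f g c d : (forall i, 0 <= f i) -> (forall i, 0 <= g i) ->
  dominated f c -> dominated g d -> dominated (fun i => f i + g i) (c + d).
Proof.
move=> f0 g0 /(dominatedP f0)[x xf xc] /(dominatedP g0)[y yg yd].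
exists (x + y) => [i|]; last by rewrite (le_trans (rnormD _ _)) // lerD.
rewrite coordD xf yg -real_complexD rnorm_real ger0_norm //.
by rewrite addr_ge0.
Qed.

Lemma dominated_sum m (w : 'I_m -> R) (g : 'I_m -> idx k -> R) (c : 'I_m -> R) :
  (forall p, 0 <= w p) -> (forall p i, 0 <= g p i) ->
  (forall p, dominated (g p) (c p)) ->
  dominated (fun i => \sum_p w p * g p i) (\sum_p w p * c p).
Proof.
move=> w0 g0 gc; elim: (index_enum _) => [|p s IH].
  exists 0 => [i|]; rewrite big_nil ?rnorm_ge0 //.
  by rewrite (rnorm0 L).
rewrite big_cons.
apply: (@dominated_le _ (fun i => w p * g p i + \sum_(q <- s) w q * g q i)) => //.
- apply: dominatedD => // [i|i|]; first exact: mulr_ge0.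
    by apply: sumr_ge0 => q _; exact: mulr_ge0.
  exact: dominatedZ.
- by move=> i; rewrite big_cons.
Qed.

(* [M] bounds the matrix [A] as an operator on [L]; only partial sums on the
   nonnegative cone are involved, so convergence questions do not arise. *)
Definition mx_bounded A M := forall f c, (forall i, 0 <= f i) ->
  dominated f c -> exists2 g, dominated g (M * c) &
    forall i n, psum (fun j => A i j * f j) n <= g i.

(** The entry is a coordinate of the image of the unit vector [e_j], and coordinates are bounded by
    the norm. *)
Lemma mx_bounded_entry A M i j : nonneg_matrix A -> mx_bounded A M -> A i j <= M.
Proof.
move=> A0 AM; have [e eE e1] := unit_vector j.
have [||g gM psum_g] := AM (fun i => (i == j)%:R) 1.
- by move=> l; rewrite ler0n.
- exists e => [l|]; last by rewrite e1.
  have -> : coord e l = (l == j)%:R%:C by rewrite eE; case: eqP.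
  by rewrite rnorm_real ler_norm.
have u0 l : 0 <= A i l * (l == j)%:R by rewrite mulr_ge0 ?ler0n.
have [n le_n] := @psum_ge_term _ _ (fun l => A i l * (l == j)%:R) j u0.
rewrite eqxx mulr1 in le_n; rewrite (le_trans le_n) // (le_trans (psum_g i n)) //.
by rewrite -[M]mulr1; exact: dominated_coord gM.
Qed.

Lemma mx_bounded_weaken A M M' : M <= M' -> mx_bounded A M -> mx_bounded A M'.
Proof.
move=> MM' AM f c f0 fc; have [g gc Ag] := AM f c f0 fc; exists g => //.
by apply: dominated_le gc _ _ => //; rewrite ler_wpM2r ?(dominated_ge0 fc).
Qed.

Lemma mx_bounded_le A B M a : nonneg_matrix A -> mx_bounded B M -> 0 <= a ->
  (forall i j, A i j <= a * B i j) -> mx_bounded A (a * M).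
Proof.
move=> A0 BM a0 AB f c f0 fc; have [g gM Bg] := BM f c f0 fc.
exists (fun i => a * g i) => [|i n]; first by rewrite -mulrA; exact: dominatedZ.
apply: le_trans (ler_wpM2l a0 (Bg i n)); rewrite /psum mulr_sumr.
by apply: ler_sum => j _; rewrite mulrA ler_wpM2r.
Qed.

Lemma mx_bounded_powR A M t : nonneg_matrix A -> 1 <= t -> 0 <= M ->
  mx_bounded A M -> mx_bounded (hadamard_pow A t) (M `^ t).
Proof.
move=> A0 t1 M0 AM; have t0 : 0 < t by exact: lt_le_trans t1.
rewrite -mulr_powRB1 // mulrC.
apply: mx_bounded_le (AM) _ _ => [i j||i j]; rewrite ?powR_ge0 //.
by apply: powR_le_mul => //; exact: mx_bounded_entry AM.
Qed.

End SequenceSpace.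

(** * Nonnegative matrices as bounded operators on [L] *)

Section MatrixOperators.
Variables (R : realType) (k : index_kind) (L : banach_seq_space R k).
Hypothesis hL : has_unit_basis L.
Implicit Types (x y : L) (f g : idx k -> R) (A B : imatrix R k) (a c d r M : R).

Definition hadamard_gmean m (A : 'I_m -> imatrix R k) : imatrix R k :=
  fun i j => gmean (fun p => A p i j).

(** With [w] tangent to [gmean] at [M], the entrywise geometric mean lies below the combination of
    the [A p] with weights [w p], whose bound is exactly [gmean M]. *)
Lemma mx_bounded_gmean m (A : 'I_m -> imatrix R k) (M : 'I_m -> R) :
  (0 < m)%N -> (forall p, nonneg_matrix (A p)) -> (forall p, 0 < M p) ->
  (forall p, mx_bounded L (A p) (M p)) ->
  mx_bounded L (hadamard_gmean A) (gmean M).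
Proof.
move=> m0 A0 M0 AM f c f0 fc; have [w [w0 wM wle]] := AGM_tangent m0 M0.
have /choice[g gP] p : exists g, dominated L g (M p * c) /\
    forall i n, psum (fun j => A p i j * f j) n <= g i.
  by have [g ? ?] := AM p f c f0 fc; exists g.
have g0 p i : 0 <= g p i.
  apply: le_trans ((gP p).2 i 0%N); apply: psum_ge0 => j.
  by rewrite mulr_ge0 //; exact: A0.
exists (fun i => \sum_p w p * g p i) => [|i n].
  rewrite -wM mulr_suml; under eq_bigr do rewrite -mulrA.
  by apply: dominated_sum => // p; exact: (gP p).1.
apply: (@le_trans _ _ (\sum_p w p * psum (fun j => A p i j * f j) n)).
  rewrite /psum; under [leRHS]eq_bigr do rewrite mulr_sumr.
  rewrite exchange_big; apply: ler_sum => j _.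
  under eq_bigr do rewrite mulrA.
  by rewrite -mulr_suml ler_wpM2r //; apply: wle => p; exact: A0.
by apply: ler_sum => p _; rewrite ler_wpM2l //; exact: (gP p).2.
Qed.

Section Operator.
Variable A : imatrix R k.
Hypotheses (A0 : forall i j, 0 <= A i j) (hA : defines_operator L A).
Let T : L -> L := matrix_op A.

Lemma matrix_opP x i :
  has_sum (fun j => (A i j)%:C * coord x j : R[i]^o) (coord (T x) i).
Proof.
have [y Ay] := hA x.
pose E := [set y : L | matrix_maps A (seq_of x) (seq_of y)].
by have /(_ i) : E (T x) by apply: xgetPex; exists y.
Qed.

Lemma matrix_op_linear : linear T.
Proof.
move=> z x y; apply: coord_inj => i; rewrite coordD coordZ.
apply: has_sum_unique (matrix_opP _ i) _.
have := has_sumD z (matrix_opP x i) (matrix_opP y i); congr (has_sum _ _).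
by apply/funext => j; rewrite coordD coordZ mulrDr mulrCA.
Qed.

Lemma matrix_op_nonneg x : nonneg_vec x -> nonneg_vec (T x).
Proof.
move=> x0 i; have /has_sumE Tx := matrix_opP x i.
have Re_u j : (A i j)%:C * coord x j = (A i j * complex.Re (coord x j))%:C.
  by rewrite {1}(nonneg_vecP x0 j).2 -real_complexM.
have Tx_Re := cvg_Re Tx.
have Re0 : 0 <= complex.Re (coord (T x) i).
  apply: cvgr_to_ge Tx_Re _; near=> n.
  rewrite /psum Re_sum sumr_ge0 // => j _.
  by rewrite Re_u mulr_ge0 // (nonneg_vecP x0 j).1.
have -> : coord (T x) i = (complex.Re (coord (T x) i))%:C.
  apply: cvg_rnorm_unique Tx (cvg_complex (b := 0) Tx_Re _).
  rewrite (_ : (fun n => _) = fun=> 0); first exact: cvg_cst.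
  by apply/funext => n; rewrite /psum Im_sum big1 // => j _; rewrite Re_u.
by rewrite ler0c.
Unshelve. all: by end_near. Qed.

Lemma matrix_op_psum x i : nonneg_vec x ->
  psum (fun j => A i j * complex.Re (coord x j)) @ \oo
    --> complex.Re (coord (T x) i).
Proof.
move=> x0; apply: has_sum_real; have := matrix_opP x i.
congr (has_sum _ _); apply/funext => j.
by rewrite {1}(nonneg_vecP x0 j).2 -real_complexM.
Qed.

Lemma matrix_op_psum_le x i n : nonneg_vec x ->
  psum (fun j => A i j * complex.Re (coord x j)) n <= complex.Re (coord (T x) i).
Proof.
move=> x0; have Tx := @matrix_op_psum x i x0.
apply: cvgr_to_ge Tx _; near=> p.
apply: psum_homo; last by near: p; exact: nbhs_infty_ge.
by move=> j; rewrite mulr_ge0 // (nonneg_vecP x0 j).1.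
Unshelve. all: by end_near. Qed.

Lemma matrix_op_rnorm_le x i c :
  (forall n, psum (fun j => A i j * rnorm (coord x j)) n <= c) ->
  rnorm (coord (T x) i) <= c.
Proof.
move=> xc; have /has_sumE Tx := matrix_opP x i.
apply: (cvg_rnorm_le (V := R[i]^o) Tx) => n; apply: le_trans (xc n).
apply: le_trans (rnorm_sum _ _) _; apply: ler_sum => j _.
by rewrite rnormM rnorm_real ger0_norm.
Qed.

Lemma matrix_op_abs x y : nonneg_vec y ->
  (forall i, rnorm (coord x i) <= complex.Re (coord y i)) ->
  rnorm (T x) <= rnorm (T y).
Proof.
move=> y0 xy; apply: rnorm_homo => i; apply: matrix_op_rnorm_le => n.
rewrite [leRHS]rnorm_nneg; last exact: matrix_op_nonneg.
by apply: le_trans (matrix_op_psum_le i n y0); apply: le_psum => j;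
  rewrite ler_wpM2l.
Qed.

Definition matrix_lin : {linear L -> L} :=
  HB.pack T (GRing.isLinear.Build _ _ _ _ T matrix_op_linear).

End Operator.

Lemma abs_vec x : exists v : L,
  [/\ nonneg_vec v, forall i, complex.Re (coord v i) = rnorm (coord x i)
    & rnorm v <= rnorm x].
Proof.
have [i|v vE vx] := dominatedP _ (dominated_vec x); first exact: rnorm_ge0.
exists v; split=> // [|i]; last by rewrite vE.
by apply: nonneg_vec_real vE => i; exact: rnorm_ge0.
Qed.

(* Gliding hump: if [T] were unbounded, a series of suitably scaled nonnegative
   vectors would have an image dominating vectors of arbitrarily large norm. *)
Lemma matrix_op_bounded A : nonneg_matrix A -> defines_operator L A ->
  exists2 M, 0 <= M & forall x : L, rnorm (matrix_op A x) <= M * rnorm x.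
Proof.
move=> A0 hA; pose T := matrix_lin hA.
suff [M TM] : exists M, forall x : L, rnorm (T x) <= M * rnorm x.
  exists (Num.max 0 M) => [|x]; first by rewrite le_max lexx.
  by rewrite (le_trans (TM x)) // ler_wpM2r ?rnorm_ge0 // le_max lexx orbT.
apply: contrapT => noM.
have /choice[x xn] n : exists x : L, n%:R * 2 ^+ n * rnorm x < rnorm (T x).
  apply: contrapT => nox; apply: noM; exists (n%:R * 2 ^+ n) => x.
  by rewrite leNgt; apply/negP => lt; apply: nox; exists x.
have x0 n : 0 < rnorm (x n).
  rewrite lt_neqAle rnorm_ge0 andbT eq_sym; apply/eqP => xn0.
  by have := xn n; rewrite xn0 (rnorm_eq0 xn0) linear0 (rnorm0 L) mulr0 ltxx.
have /choice[v vP] n := abs_vec (x n).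
(* This scaling gives [y n] norm at most [2^-n], so the series converges, while the image of [y n]
   still has norm above [n]. *)
pose q n := (2 ^+ n * rnorm (x n))^-1.
have q0 n : 0 <= q n by rewrite invr_ge0 mulr_ge0 ?exprn_ge0 // ltW.
pose y n : L := (q n)%:C *: v n.
have [P0 PD PZ Pl] := nonneg_vec_cone hL.
have y0 n : nonneg_vec (y n) by apply: (PZ) => //; case: (vP n).
pose S n := \sum_(0 <= i < n) y i.
have SS n : S n.+1 = S n + y n by rewrite /S big_nat_recr.
have [s Ss] : exists s : L, S @ \oo --> s.
  apply: (@geometric_cauchy _ _ _ 1 2^-1); rewrite ?invf_lt1 ?ltr1n // => n.
  rewrite SS addrAC subrr add0r rnormZ_real // mul1r.
  have [_ _ vx] := vP n; apply: le_trans (ler_wpM2l (q0 n) vx) _.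
  by rewrite /q invfM -mulrA mulVf ?lt0r_neq0 // mulr1 exprVn.
(* All terms being nonnegative, the total [s] dominates each [y n], hence [T s] dominates every
   [T (y n)]. *)
have sy n : nonneg_vec (s - y n).
  apply: (Pl (fun p => S (n.+1 + p)%N - y n)) => [p|].
    elim: p => [|p IH].
      rewrite addn0 SS addrK /S; elim: n => [|n IH]; first by rewrite big_nil.
      by rewrite big_nat_recr //=; exact: (PD).
    by rewrite addnS SS addrAC; exact: (PD).
  apply: cvgB; last exact: cvg_cst.
  rewrite (_ : (fun p => _) = (fun p => S (p + n.+1)%N)) ?cvg_shiftn //.
  by apply/funext => p; rewrite addnC.
have lt_n n : n%:R < rnorm (T s).
  apply: (@lt_le_trans _ _ (rnorm (T (y n)))); last first.
    apply: nonneg_vec_rnorm; first exact: matrix_op_nonneg.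
    by rewrite -linearB; exact: matrix_op_nonneg.
  rewrite linearZ rnormZ_real // /q mulrC ltr_pdivlMr ?mulr_gt0 ?exprn_gt0 //.
  rewrite mulrA; apply: lt_le_trans (xn n) _.
  have [v0 vx _] := vP n; apply: matrix_op_abs => // i.
  by rewrite vx.
have := lt_n (Num.bound (rnorm (T s))).
by rewrite ltNge ltW // archi_boundP ?rnorm_ge0.
Qed.

Lemma matrix_norm_ge0 A : 0 <= matrix_norm L A.
Proof.
rewrite /matrix_norm /opnorm; set E := [set _ | _ in _].
(* When the supremum does not exist, [sup] is 0 and the bound holds trivially. *)
have [hE|/sup_out ->] := pselect (has_sup E); last by [].
have [z Ez] := hE.1; apply: le_trans (sup_upper_bound hE Ez).
by case: Ez => x _ <-; exact: rnorm_ge0.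
Qed.

Lemma matrix_normP A x : nonneg_matrix A -> defines_operator L A ->
  rnorm (matrix_op A x) <= matrix_norm L A * rnorm x.
Proof.
move=> A0 hA; have [M M0 TM] := matrix_op_bounded A0 hA.
have [x0|x0] := eqVneq (rnorm x) 0.
  by rewrite (le_trans (TM x)) // x0 !mulr0.
have x1 : 0 < rnorm x by rewrite lt_neqAle eq_sym x0 rnorm_ge0.
rewrite -ler_pdivrMr // mulrC -rnormZ_real ?invr_ge0 ?rnorm_ge0 //.
have /= <- := linearZ_LR (matrix_lin hA).
apply: ub_le_sup; last first.
  exists ((rnorm x)^-1%:C *: x) => //=.
  by rewrite rnormZ_real ?invr_ge0 ?rnorm_ge0 // mulVf.
exists M => _ [z /= z1 <-]; apply: le_trans (TM z) _.
by rewrite -[leRHS]mulr1 ler_wpM2l.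
Qed.

Lemma matrix_norm_le A M : 0 <= M ->
  (forall x : L, rnorm (matrix_op A x) <= M * rnorm x) -> matrix_norm L A <= M.
Proof.
move=> M0 TM; apply: ge_sup => [|_ [z /= z1 <-]].
  by exists (rnorm (matrix_op A (0 : L))); exists 0; rewrite //= (rnorm0 L) ler01.
by apply: le_trans (TM z) _; rewrite -[leRHS]mulr1 ler_wpM2l.
Qed.

Lemma defines_operator_mx_bounded A : nonneg_matrix A -> defines_operator L A ->
  mx_bounded L A (matrix_norm L A).
Proof.
move=> A0 hA f c f0 /(dominatedP f0)[x xf xc].
have x0 := nonneg_vec_real f0 xf.
exists (fun i => complex.Re (coord (matrix_op A x) i)) => [|i n].
  exists (matrix_op A x) => [i|].
    exact: le_trans (ler_norm _) (rnorm_Re_le _).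
  by rewrite (le_trans (matrix_normP _ A0 hA)) // ler_wpM2l ?matrix_norm_ge0.
have := matrix_op_psum_le A0 hA i n x0; congr (_ n <= _).
by congr psum; apply/funext => j; rewrite xf.
Qed.

(** Bounded partial sums make each row sum absolutely convergent, and the ideal property places the
    resulting sequence in [L]. *)
Lemma mx_bounded_defines_operator A M : nonneg_matrix A -> mx_bounded L A M ->
  defines_operator L A.
Proof.
move=> A0 AM x.
have [g gM psum_g] := AM _ _ (fun i => rnorm_ge0 _) (dominated_vec x).
have /choice[z zP] i : exists z, has_sum (fun j => (A i j)%:C * coord x j : R[i]^o) z
    /\ rnorm z <= g i.
  have [j|z] := @has_sum_abs _ _ (fun j => (A i j)%:C * coord x j : R[i]^o) _ _ _
    (psum_g i); last by exists z.
  by rewrite rnormM rnorm_real ger0_norm.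
have [v gv vM] := gM.
have [i|y yz _] := @ideal_rnorm _ _ _ z v.
  exact: le_trans (zP i).2 (gv i).
by exists y => i; have := (zP i).1; rewrite -yz.
Qed.

Lemma mx_bounded_rnorm A M x : nonneg_matrix A -> mx_bounded L A M ->
  rnorm (matrix_op A x) <= M * rnorm x.
Proof.
move=> A0 AM; have hA := mx_bounded_defines_operator A0 AM.
have [g [v gv vM] psum_g] := AM _ _ (fun i => rnorm_ge0 _) (dominated_vec x).
apply: le_trans vM; apply: rnorm_homo => i; apply: le_trans (gv i).
exact: matrix_op_rnorm_le.
Qed.

Lemma mx_bounded_norm A M : 0 <= M -> nonneg_matrix A -> mx_bounded L A M ->
  matrix_norm L A <= M.
Proof.
by move=> M0 A0 AM; apply: matrix_norm_le => // x; exact: mx_bounded_rnorm.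
Qed.

End MatrixOperators.

(** * Spectral radius *)

Section SpectralRadius.
Variables (R : realType) (k : index_kind) (L : banach_seq_space R k).
Hypothesis hL : has_unit_basis L.
Implicit Types (x y : L) (f g : idx k -> R) (A B s : imatrix R k) (r M K : R).

Lemma rho_ge0 A : 0 <= rho L A.
Proof.
rewrite /rho /spectral_radius; set E := [set _ | _ in _].
have [hE|/sup_out ->] := pselect (has_sup E); last by [].
have [z Ez] := hE.1; apply: le_trans (sup_upper_bound hE Ez).
by case: Ez => l _ <-; exact: (rnorm_ge0 (V := R[i]^o)).
Qed.

Lemma spectrum_le A K r (l : R[i]^o) (hA : defines_operator L A) : 0 <= r ->
  (forall n (x : L), rnorm (iter n (matrix_op A) x) <= K * r ^+ n * rnorm x) ->
  spectrum (@matrix_op R k L A) l -> rnorm l <= r.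
Proof.
move=> r0 Ar Sl; rewrite leNgt; apply/negP => rl; apply: Sl.
have [S [cS SL SR _]] := neumann_resolvent (T := matrix_lin hA) r0 rl Ar.
by exists S.
Qed.

(** Boundedness of the operator bounds the spectrum, so that the supremum defining [rho] really is
    an upper bound for the moduli of spectral points. *)
Lemma rho_lt_resolvent A r t : nonneg_matrix A -> defines_operator L A ->
  rho L A < r -> r <= t -> resolvent_set (@matrix_op R k L A) t%:C.
Proof.
move=> A0 hA Ar rt; apply: contrapT => nres.
have [M M0 AM] := matrix_op_bounded hL A0 hA.
suff : t <= rho L A by rewrite leNgt (lt_le_trans Ar rt).
have t0 : 0 <= t by exact: le_trans (rho_ge0 A) (le_trans (ltW Ar) rt).
apply: ub_le_sup; last first.
  by exists t%:C => //; rewrite (rnorm_real t) ger0_norm.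
exists M => _ [l Sl <-]; apply: (spectrum_le (K := 1) hA M0) Sl => n x.
by rewrite mul1r; exact: (iter_bound (T := matrix_lin hA)).
Qed.

(* For [r] above the spectral radius of [A], [s := r (r - A)^-1] will do.  Unlike
   the resolvent, this certificate is preserved by Hadamard powers and geometric
   means. *)
Definition supersolution A r s :=
  [/\ nonneg_matrix s, forall i, 1 <= s i i,
      exists2 K, 0 <= K & mx_bounded L s K
    & forall i j n, psum (fun l => A i l * s l j) n <= r * s i j].

Lemma rho_lt_supersolution A r : nonneg_matrix A -> defines_operator L A ->
  rho L A < r -> exists s, supersolution A r s.
Proof.
move=> A0 hA Ar; have r0 : 0 < r by exact: le_lt_trans (rho_ge0 A) Ar.
have AM x : rnorm (matrix_lin hA x) <= matrix_norm L A * rnorm x.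
  exact: matrix_normP.
have [S [K [K0 SK SP SR]]] := positive_resolvent (T := matrix_lin hA)
  (nonneg_vec_cone hL) (matrix_op_nonneg A0 hA) AM r0
  (fun t => rho_lt_resolvent A0 hA Ar).
have /choice[e eE] i : exists e : L, forall j, coord e j = ((j == i)%:R)%:C.
  by have [e eE _] := unit_vector hL i; exists e => j; rewrite eE; case: eqP.
have e0 i : nonneg_vec (e i).
  by apply: nonneg_vec_real (eE i) => j; rewrite ler0n.
have Se0 i : nonneg_vec (S (e i)) by exact: SP.
have SRe x i : r * complex.Re (coord (S x) i) -
    complex.Re (coord (matrix_op A (S x)) i) = complex.Re (coord x i).
  rewrite -[in RHS](SR x) coordB coordZ ReB; congr (_ - _).
  by case: (coord (S x) i) => u v /=; rewrite mul0r subr0.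
exists (fun i j => r * complex.Re (coord (S (e j)) i)); split.
- by move=> i j; rewrite mulr_ge0 ?(ltW r0) // (nonneg_vecP (Se0 j) i).1.
(* The diagonal entry is the [i]-th coordinate of [r S e_i = e_i + A S e_i], and the last vector is
   nonnegative. *)
- move=> i; have <- : complex.Re (coord (e i) i) = 1 by rewrite eE eqxx.
  by rewrite -SRe gerBl; exact: (nonneg_vecP (matrix_op_nonneg A0 hA (Se0 i)) i).1.
- exists (r * K) => [|f c f0 /(dominatedP f0)[v vf vc]].
    by rewrite mulr_ge0 // ltW.
  have v0 := nonneg_vec_real f0 vf.
  exists (fun i => r * complex.Re (coord (S v) i)) => [|i n].
    rewrite -mulrA; apply: dominatedZ; first exact: ltW.
    exists (S v) => [i|]; first exact: le_trans (ler_norm _) (rnorm_Re_le _).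
    by rewrite (le_trans (SK v)) // ler_wpM2l.
  (* The finite section [u] of [v] satisfies [S u <= S v] by positivity. This bounds the partial
     sums of the matrix of [S] without showing that [S] is given by its matrix. *)
  pose u : L := \sum_(j <- sec k n) (f j)%:C *: e j.
  have uv : nonneg_vec (v - u).
    move=> j; rewrite coordB vf coord_sum.
    under eq_bigr => l _ do rewrite coordZ eE -real_complexM.
    rewrite -real_complex_sum -rmorphB ler0c subr_ge0.
    have [jn|jn] := boolP (j \in sec k n).
      rewrite (bigD1_seq j) ?sec_uniq //= eqxx mulr1 big1 ?addr0 // => l lj.
      by rewrite eq_sym (negPf lj) mulr0.
    rewrite big_seq big1 // => l ln; case: eqP => [jl|_]; last by rewrite mulr0.
    by rewrite jl ln in jn.
  have := (nonneg_vecP (SP _ uv) i).1.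
  rewrite linearB coordB ReB subr_ge0 => Su.
  rewrite (_ : psum _ n = r * complex.Re (coord (S u) i)) ?ler_wpM2l ?(ltW r0) //.
  rewrite /u linear_sum coord_sum Re_sum mulr_sumr; apply: eq_bigr => j _.
  rewrite linearZ coordZ -mulrA; congr (_ * _).
  by case: (coord (S (e j)) i) => a b /=; rewrite mul0r subr0 mulrC.
move=> i j n.
have -> : psum (fun l => A i l * (r * complex.Re (coord (S (e j)) l))) n =
    r * psum (fun l => A i l * complex.Re (coord (S (e j)) l)) n.
  by rewrite /psum mulr_sumr; apply: eq_bigr => l _; rewrite mulrCA.
rewrite ler_wpM2l ?(ltW r0) //; apply: le_trans (matrix_op_psum_le A0 hA i n (Se0 j)) _.
by rewrite -subr_ge0 SRe eE ler0n.
Qed.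

(** Put [y = s |x|]. The diagonal condition gives [|x| <= y] and the supersolution inequality gives
    [A y <= r y]; hence [|A^n x| <= r^n y], with [y] of norm at most [K] times that of [x], and the
    Neumann series excludes spectrum beyond [r]. *)
Lemma supersolution_rho_le A r s : nonneg_matrix A -> defines_operator L A ->
  0 <= r -> supersolution A r s -> rho L A <= r.
Proof.
move=> A0 hA r0 [s0 s1 [K K0 sK] As].
suff Ar n (x : L) : rnorm (iter n (matrix_op A) x) <= K * r ^+ n * rnorm x.
  rewrite /rho /spectral_radius; set E := [set _ | _ in _].
  have [[E0 _]|/sup_out ->//] := pselect (has_sup E).
  by apply: ge_sup => // _ [l Sl <-]; exact: spectrum_le hA r0 Ar Sl.
pose f i := rnorm (coord x i); have f0 i : 0 <= f i by exact: rnorm_ge0.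
have [g gK sg] := sK f _ f0 (dominated_vec x).
have /choice[y yP] i : exists l : R, [/\ psum (fun j => s i j * f j) @ \oo --> l,
    forall p, psum (fun j => s i j * f j) p <= l & l <= g i].
  by apply: psum_cvg => // j; rewrite mulr_ge0 //; exact: s0.
have fy i : f i <= y i.
  have u0 j : 0 <= s i j * f j by rewrite mulr_ge0 //; exact: s0.
  have [p] := @psum_ge_term _ _ (fun j => s i j * f j) i u0.
  have [_ le_y _] := yP i; move=> /le_trans/(_ (le_y p)).
  by apply: le_trans; rewrite ler_peMl.
have Ay i p : psum (fun l => A i l * y l) p <= r * y i.
  (* Both sides are limits of expressions truncated at [q], so only finite sums have to be
     exchanged. *)
  have lhs : (fun q => psum (fun l => A i l * psum (fun j => s l j * f j) q) p)
      @ \oo --> psum (fun l => A i l * y l) p.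
    apply: cvg_big => [|l _]; first exact: add_continuous.
    by apply: cvgMr; case: (yP l).
  have rhs : (fun q => r * psum (fun j => s i j * f j) q) @ \oo --> r * y i.
    by apply: cvgMr; case: (yP i).
  apply: ler_cvg_to lhs rhs _; near=> q.
  rewrite /psum; under eq_bigr do rewrite mulr_sumr.
  rewrite exchange_big mulr_sumr; apply: ler_sum => j _.
  under eq_bigr do rewrite mulrA.
  by rewrite -mulr_suml mulrA ler_wpM2r //; exact: As.
have iter_le i : rnorm (coord (iter n (matrix_op A) x) i) <= r ^+ n * y i.
  elim: n i => [|n IH] i; first by rewrite mul1r; exact: fy.
  rewrite iterS; apply: matrix_op_rnorm_le => // p.
  apply: (@le_trans _ _ (r ^+ n * psum (fun l => A i l * y l) p)).
    rewrite /psum mulr_sumr; apply: ler_sum => l _.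
    by rewrite mulrCA ler_wpM2l.
  by rewrite exprSr -mulrA ler_wpM2l ?exprn_ge0.
have [v gv vK] := dominatedZ (exprn_ge0 n r0) gK.
rewrite mulrAC mulrC; apply: le_trans vK; apply: rnorm_homo => i.
apply: le_trans (iter_le i) _; apply: le_trans (gv i).
by rewrite ler_wpM2l ?exprn_ge0 //; case: (yP i).
Unshelve. all: by end_near. Qed.

Lemma supersolution_powR A r s t : 1 <= t -> nonneg_matrix A -> 0 <= r ->
  supersolution A r s -> supersolution (hadamard_pow A t) (r `^ t) (hadamard_pow s t).
Proof.
move=> t1 A0 r0 [s0 s1 [K K0 sK] As]; have t0 : 0 <= t by exact: le_trans t1.
have s_ge0 i j : 0 <= s i j by exact: s0.
split.
- by move=> i j; exact: powR_ge0.
- move=> i; apply: (@le_trans _ _ (1 `^ t)); first by rewrite powR1.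
  by apply: ge0_ler_powR; rewrite ?nnegrE ?ler01 ?s_ge0.
- by exists (K `^ t); [exact: powR_ge0|exact: mx_bounded_powR].
move=> i j n; rewrite -powRM //.
apply: (@le_trans _ _ (psum (fun l => A i l * s l j) n `^ t)); last first.
  apply: ge0_ler_powR => //; rewrite ?nnegrE ?mulr_ge0 //.
  by apply: psum_ge0 => l; rewrite mulr_ge0 //; exact: A0.
apply: le_trans (powR_sum_le _ t1 _); last first.
  by move=> l; rewrite mulr_ge0 //; exact: A0.
by apply: ler_sum => l _; rewrite powRM //; exact: A0.
Qed.

Lemma supersolution_gmean m (A s : 'I_m -> imatrix R k) (r : 'I_m -> R) :
  (0 < m)%N -> (forall p, nonneg_matrix (A p)) -> (forall p, 0 <= r p) ->
  (forall p, supersolution (A p) (r p) (s p)) ->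
  supersolution (hadamard_gmean A) (gmean r) (hadamard_gmean s).
Proof.
move=> m0 A0 r0 sP.
have s0 p i j : 0 <= s p i j by case: (sP p) => s0 _ _ _; exact: s0.
split.
- by move=> i j; exact: gmean_ge0.
- move=> i; apply: (@le_trans _ _ (@gmean R m (fun=> 1))).
    by rewrite /gmean big1 // powR1.
  by apply: gmean_le => // p; case: (sP p).
- have /choice[K sK] p : exists K : R, 0 <= K /\ mx_bounded L (s p) K.
    by case: (sP p) => _ _ [K] *; exists K.
  (* Some [K p] may be 0, whereas the tangent argument requires positive bounds. *)
  exists (gmean (fun p => K p + 1)); first exact: gmean_ge0.
  apply: mx_bounded_gmean => // p; have [K0 sK_p] := sK p.
    by rewrite ltr_wpDl.
  by apply: mx_bounded_weaken sK_p; rewrite lerDl.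
move=> i j n; rewrite -gmeanM //.
apply: le_trans (gmean_le m0 _ _); last 1 first.
- by move=> p; case: (sP p) => _ _ _ As; exact: (As i j n).
- rewrite /psum (eq_bigr (fun l => gmean (fun p => A p i l * s p l j))); last first.
    by move=> l _; rewrite gmeanM // => p; exact: A0.
  by apply: hoelder_gmean => // p l; rewrite mulr_ge0 //; exact: A0.
by move=> p; apply: psum_ge0 => l; rewrite mulr_ge0 //; exact: A0.
Qed.

End SpectralRadius.

(** * Numerical radius *)

Section NumericalRadius.
Variables (R : realType) (k : index_kind) (L : banach_seq_space R k).
Hypothesis hL : has_unit_basis L.
Hypothesis l2L : is_l2 L.
Implicit Types (x y : L) (f g : idx k -> R) (A B : imatrix R k) (M : R).

Lemma rnorm_conjc (z : R[i]^o) : rnorm (conjc z : R[i]^o) = rnorm z.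
Proof. by case: z => a b; rewrite /rnorm !normc_def /= sqrrN. Qed.

Lemma psum_rnorm_sqr x n : psum (fun i => rnorm (coord x i) ^+ 2) n <= rnorm x ^+ 2.
Proof.
have x2 : psum (fun i => rnorm (coord x i) ^+ 2) @ \oo
    --> complex.Re (`|x| ^+ 2 : R[i]^o).
  apply: has_sum_real; have := l2L.2 x; congr (has_sum _ _).
  by apply/funext => i; rewrite expr2 real_complexM rnormE.
have -> : rnorm x ^+ 2 = complex.Re (`|x| ^+ 2 : R[i]^o).
  by rewrite -rnormE !expr2 -real_complexM.
apply: cvgr_to_ge x2 _; near=> p; apply: psum_homo; first by move=> j; exact: sqr_ge0.
by near: p; exact: nbhs_infty_ge.
Unshelve. all: by end_near. Qed.

(** The termwise inequality [2ab <= a^2 + b^2] gives absolute convergence and a bound good enough to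
    show that the set defining the numerical radius is bounded. *)
Lemma inner_product_exists x y : exists2 s : R[i]^o,
  has_sum (fun i => coord x i * conjc (coord y i) : R[i]^o) s &
  rnorm s <= (rnorm x ^+ 2 + rnorm y ^+ 2) / 2.
Proof.
apply: (@has_sum_abs _ _ _
  (fun i => (rnorm (coord x i) ^+ 2 + rnorm (coord y i) ^+ 2) / 2)) => [i|n].
  rewrite rnormM rnorm_conjc ler_pdivlMr // -subr_ge0.
  rewrite (_ : _ - _ = (rnorm (coord x i) - rnorm (coord y i)) ^+ 2).
    exact: sqr_ge0.
  by rewrite sqrrB; ring.
rewrite /psum -mulr_suml big_split ler_pM2r ?invr_gt0 //.
by apply: lerD; exact: psum_rnorm_sqr.
Qed.

Lemma matrix_w_ge0 A : 0 <= matrix_w L A.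
Proof.
rewrite /matrix_w /numerical_radius; set E := [set _ | _].
have [hE|/sup_out ->] := pselect (has_sup E); last by [].
have [z Ez] := hE.1; apply: le_trans (sup_upper_bound hE Ez).
by case: Ez => f [s [_ _ ->]]; exact: (rnorm_ge0 (V := R[i]^o)).
Qed.

(** For nonnegative [x] all terms are nonnegative, so truncating both sums only decreases the
    quadratic form. *)
Lemma quadratic_form_le_matrix_w A x n p : nonneg_matrix A ->
  defines_operator L A -> nonneg_vec x -> rnorm x = 1 ->
  psum (fun i => complex.Re (coord x i) *
    psum (fun j => A i j * complex.Re (coord x j)) p) n <= matrix_w L A.
Proof.
move=> A0 hA x0 x1; pose T := @matrix_op R k L A.
have [s Ts _] := inner_product_exists (T x) x.
have Tx0 : nonneg_vec (T x) by exact: matrix_op_nonneg.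
have ReT i := (nonneg_vecP Tx0 i).1; have Rex i := (nonneg_vecP x0 i).1.
have Re_s : psum (fun i => complex.Re (coord (T x) i) * complex.Re (coord x i))
    @ \oo --> complex.Re s.
  apply: has_sum_real; move: Ts; congr (has_sum _ _); apply/funext => i.
  have -> : conjc (coord x i) = (complex.Re (coord x i))%:C.
    by rewrite {1}(nonneg_vecP x0 i).2 conjc_real.
  by rewrite {1}(nonneg_vecP Tx0 i).2 -real_complexM.
apply: (@le_trans _ _ (complex.Re s)).
  apply: (@le_trans _ _ (psum (fun i => complex.Re (coord (T x) i) *
    complex.Re (coord x i)) n)).
    apply: le_psum => i; rewrite mulrC ler_wpM2r //.
    exact: matrix_op_psum_le.
  apply: cvgr_to_ge Re_s _; near=> q.
  apply: psum_homo; first by move=> j; rewrite mulr_ge0.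
  by near: q; exact: nbhs_infty_ge.
apply: le_trans (ler_norm _) _; apply: le_trans (rnorm_Re_le _) _.
have [M M0 TM] := matrix_op_bounded hL A0 hA.
apply: ub_le_sup; last by exists x, s; split; rewrite // -rnormE x1.
exists ((M ^+ 2 + 1) / 2) => _ [f [z [f1 Tz ->]]].
have rf1 : rnorm f = 1 by rewrite /rnorm f1.
have [z' Tz' z'le] := inner_product_exists (T f) f.
have -> : z = z' by exact: has_sum_unique Tz Tz'.
apply: le_trans z'le _; rewrite rf1 expr1n ler_pM2r ?invr_gt0 // lerD2r.
have := TM f; rewrite rf1 mulr1 => le_M.
by rewrite lerXn2r // nnegrE rnorm_ge0.
Unshelve. all: by end_near. Qed.

(** Replacing [f] by its modulus does not change its norm and can only increase the modulus of the
    form, so truncated forms at nonnegative unit vectors control the numerical radius. *)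
Lemma matrix_w_le A M : nonneg_matrix A -> defines_operator L A -> 0 <= M ->
  (forall x n p, nonneg_vec x -> rnorm x = 1 ->
    psum (fun i => complex.Re (coord x i) *
      psum (fun j => A i j * complex.Re (coord x j)) p) n <= M) ->
  matrix_w L A <= M.
Proof.
move=> A0 hA M0 AM; rewrite /matrix_w /numerical_radius; set E := [set _ | _].
have [[E0 _]|/sup_out ->//] := pselect (has_sup E).
apply: ge_sup => // _ [f [s [f1 /has_sumE Ts ->]]].
have [v [v0 vf vle]] := abs_vec f.
have v1 : rnorm v = 1.
  have -> : 1 = rnorm f by rewrite /rnorm f1.
  apply/le_anti; rewrite vle /=; apply: rnorm_homo => i.
  by rewrite -vf; apply: le_trans (ler_norm _) (rnorm_Re_le _).
apply: (cvg_rnorm_le (V := R[i]^o) Ts) => n.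
apply: (@le_trans _ _ (psum (fun i => complex.Re (coord v i) *
    complex.Re (coord (matrix_op A v) i)) n)).
  apply: le_trans (rnorm_sum _ _) _; apply: ler_sum => i _.
  rewrite rnormM rnorm_conjc mulrC vf ler_wpM2l ?rnorm_ge0 //.
  apply: matrix_op_rnorm_le => // p.
  apply: le_trans (matrix_op_psum_le A0 hA i p v0).
  by apply: le_psum => j; rewrite vf.
have lim : (fun p => psum (fun i => complex.Re (coord v i) *
    psum (fun j => A i j * complex.Re (coord v j)) p) n) @ \oo -->
    psum (fun i => complex.Re (coord v i) *
      complex.Re (coord (matrix_op A v) i)) n.
  apply: cvg_big => [|i _]; first exact: add_continuous.
  by apply: cvgMr; exact: matrix_op_psum.
by apply: cvgr_to_le lim _; near=> p; exact: AM.
Unshelve. all: by end_near. Qed.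

(** The truncated quadratic form at a nonnegative vector is monotone and linear in the matrix, so
    the tangent combination passes through it. *)
Lemma matrix_w_gmean m (A : 'I_m -> imatrix R k) : (0 < m)%N ->
  (forall p, nonneg_matrix (A p)) -> (forall p, defines_operator L (A p)) ->
  defines_operator L (hadamard_gmean A) ->
  matrix_w L (hadamard_gmean A) <= gmean (fun p => matrix_w L (A p)).
Proof.
move=> m0 A0 hA hB; apply: gmean_ge_approx => // [p|y wy].
  exact: matrix_w_ge0.
have y0 p : 0 < y p by apply: le_lt_trans (wy p); exact: matrix_w_ge0.
have [w [w0 <- wle]] := AGM_tangent m0 y0.
apply: matrix_w_le => // [i j||x n q x0 x1]; first exact: gmean_ge0.
  by apply: sumr_ge0 => p _; rewrite mulr_ge0 // ltW.
have Rex i := (nonneg_vecP x0 i).1.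
apply: (@le_trans _ _ (\sum_p w p * psum (fun i => complex.Re (coord x i) *
    psum (fun j => A p i j * complex.Re (coord x j)) q) n)); last first.
  apply: ler_sum => p _; rewrite ler_wpM2l //; apply: le_trans (ltW (wy p)).
  exact: quadratic_form_le_matrix_w.
rewrite /psum; under [leRHS]eq_bigr do rewrite mulr_sumr.
rewrite exchange_big; apply: ler_sum => i _.
under [leRHS]eq_bigr do rewrite mulrCA.
rewrite -mulr_sumr ler_wpM2l //.
under [leRHS]eq_bigr do rewrite mulr_sumr.
rewrite exchange_big; apply: ler_sum => j _.
under [leRHS]eq_bigr do rewrite mulrA.
by rewrite -mulr_suml ler_wpM2r //; apply: wle => p; exact: A0.
Qed.

End NumericalRadius.

(** * Hadamard means *)

Section HadamardMeans.
Variables (R : realType) (k : index_kind) (L : banach_seq_space R k).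
Hypothesis hL : has_unit_basis L.
Implicit Types (A : imatrix R k) (r s t : R).

Lemma hadamard_pow_nonneg A t : nonneg_matrix (hadamard_pow A t).
Proof. by move=> i j; exact: powR_ge0. Qed.

Lemma hadamard_powM A s t :
  hadamard_pow A (s * t) = hadamard_pow (hadamard_pow A s) t.
Proof. by apply/funext => i; apply/funext => j; exact: powRrM. Qed.

(** Identifies the product with the geometric mean of [m]-th Hadamard powers, which corresponds to
    the endpoint [t = m]. *)
Lemma hadamard_prod_gmean m (A : 'I_m -> imatrix R k) : (0 < m)%N ->
  (forall p, nonneg_matrix (A p)) ->
  hadamard_prod A = hadamard_gmean (fun p => hadamard_pow (A p) m%:R).
Proof.
move=> m0 A0; apply/funext => i; apply/funext => j.
by rewrite /hadamard_gmean gmean_powR // => p; exact: A0.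
Qed.

Lemma hadamard_pow_mx_bounded A t : 1 <= t -> nonneg_matrix A ->
  defines_operator L A -> mx_bounded L (hadamard_pow A t) (matrix_norm L A `^ t).
Proof.
move=> t1 A0 hA; apply: mx_bounded_powR => //; first exact: matrix_norm_ge0.
exact: defines_operator_mx_bounded.
Qed.

Lemma hadamard_pow_defines_operator A t : 1 <= t -> nonneg_matrix A ->
  defines_operator L A -> defines_operator L (hadamard_pow A t).
Proof.
move=> t1 A0 hA; apply: mx_bounded_defines_operator.
  exact: hadamard_pow_nonneg.
exact: hadamard_pow_mx_bounded.
Qed.

Lemma matrix_norm_powR A t : 1 <= t -> nonneg_matrix A -> defines_operator L A ->
  matrix_norm L (hadamard_pow A t) <= matrix_norm L A `^ t.
Proof.
move=> t1 A0 hA; apply: mx_bounded_norm; first exact: powR_ge0.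
  exact: hadamard_pow_nonneg.
exact: hadamard_pow_mx_bounded.
Qed.

(** A supersolution for [rho L A + e] is raised to the power [t]. Comparing [t]-th roots keeps the
    error [e] additive, so it can be removed directly. *)
Lemma rho_powR A t : 1 <= t -> nonneg_matrix A -> defines_operator L A ->
  rho L (hadamard_pow A t) <= rho L A `^ t.
Proof.
move=> t1 A0 hA; have t0 : 0 < t by exact: lt_le_trans t1.
have powK a : 0 <= a -> (a `^ t) `^ t^-1 = a.
  by move=> a0; rewrite -powRrM mulfV ?lt0r_neq0 // powRr1.
have le1 : rho L (hadamard_pow A t) `^ t^-1 <= rho L A.
  apply/ler_addgt0Pr => e e0; set r := rho L A + e.
  have r_gt : rho L A < r by rewrite ltrDl.
  have r0 : 0 <= r by rewrite addr_ge0 ?rho_ge0 // ltW.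
  have [s sA] := rho_lt_supersolution hL A0 hA r_gt.
  rewrite -(powK r r0); apply: ge0_ler_powR; rewrite ?nnegrE ?rho_ge0 ?powR_ge0 //.
    by rewrite invr_ge0 ltW.
  apply: supersolution_rho_le (supersolution_powR hL t1 A0 r0 sA) => //.
  - exact: hadamard_pow_nonneg.
  - exact: hadamard_pow_defines_operator.
  - exact: powR_ge0.
have powVK a : 0 <= a -> (a `^ t^-1) `^ t = a.
  by move=> a0; rewrite -powRrM mulVf ?lt0r_neq0 // powRr1.
rewrite -[leLHS]powVK; last exact: rho_ge0.
by apply: ge0_ler_powR; rewrite ?nnegrE ?powR_ge0 ?rho_ge0 // ltW.
Qed.

Lemma hadamard_gmean_defines_operator m (A : 'I_m -> imatrix R k) : (0 < m)%N ->
  (forall p, nonneg_matrix (A p)) -> (forall p, defines_operator L (A p)) ->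
  defines_operator L (hadamard_gmean A).
Proof.
move=> m0 A0 hA; apply: (mx_bounded_defines_operator
  (M := gmean (fun p => matrix_norm L (A p) + 1))).
  by move=> i j; exact: gmean_ge0.
apply: mx_bounded_gmean => // p; first by rewrite ltr_wpDl ?matrix_norm_ge0.
apply: mx_bounded_weaken (defines_operator_mx_bounded hL (A0 p) (hA p)).
by rewrite lerDl.
Qed.

Lemma matrix_norm_gmean m (A : 'I_m -> imatrix R k) : (0 < m)%N ->
  (forall p, nonneg_matrix (A p)) -> (forall p, defines_operator L (A p)) ->
  matrix_norm L (hadamard_gmean A) <= gmean (fun p => matrix_norm L (A p)).
Proof.
move=> m0 A0 hA; apply: gmean_ge_approx => // [p|y Ay].
  exact: matrix_norm_ge0.
apply: mx_bounded_norm; first exact: gmean_ge0.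
  by move=> i j; exact: gmean_ge0.
apply: mx_bounded_gmean => // p.
  exact: le_lt_trans (matrix_norm_ge0 _ _) (Ay p).
apply: mx_bounded_weaken (defines_operator_mx_bounded hL (A0 p) (hA p)).
exact: ltW.
Qed.

Lemma rho_gmean m (A : 'I_m -> imatrix R k) : (0 < m)%N ->
  (forall p, nonneg_matrix (A p)) -> (forall p, defines_operator L (A p)) ->
  rho L (hadamard_gmean A) <= gmean (fun p => rho L (A p)).
Proof.
move=> m0 A0 hA; apply: gmean_ge_approx => // [p|y Ay]; first exact: rho_ge0.
have /choice[s sP] p := rho_lt_supersolution hL (A0 p) (hA p) (Ay p).
have y0 p : 0 <= y p by exact: le_trans (rho_ge0 _ _) (ltW (Ay p)).
apply: supersolution_rho_le (supersolution_gmean m0 A0 y0 sP).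
- by move=> i j; exact: gmean_ge0.
- exact: hadamard_gmean_defines_operator.
- exact: gmean_ge0.
Qed.

(** Stated for a general [phi] to serve both [rho] and the norm: the [t]-th Hadamard power is the
    [t / s]-th power of the [s]-th one, and [t / s >= 1]. *)
Lemma hadamard_mean_decreasing m (A : 'I_m -> imatrix R k)
    (phi : imatrix R k -> R) :
  (forall p, nonneg_matrix (A p)) -> (forall p, defines_operator L (A p)) ->
  (forall B, 0 <= phi B) ->
  (forall B t, 1 <= t -> nonneg_matrix B -> defines_operator L B ->
     phi (hadamard_pow B t) <= phi B `^ t) ->
  forall s t, 1 <= s -> s <= t ->
    (\prod_(p < m) phi (hadamard_pow (A p) t)) `^ t^-1 <=
    (\prod_(p < m) phi (hadamard_pow (A p) s)) `^ s^-1.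
Proof.
move=> A0 hA phi0 phi_pow s t s1 st.
have s0 : 0 < s by exact: lt_le_trans s1.
have t0 : 0 < t by exact: lt_le_trans st.
have u1 : 1 <= t / s by rewrite ler_pdivlMr // mul1r.
have tE : t = s * (t / s) by rewrite mulrCA mulfV ?mulr1 // lt0r_neq0.
have prod_pow : \prod_(p < m) phi (hadamard_pow (A p) t) <=
    (\prod_(p < m) phi (hadamard_pow (A p) s)) `^ (t / s).
  apply: (@le_trans _ _ (\prod_(p < m) phi (hadamard_pow (A p) s) `^ (t / s))).
    apply: ler_prod => p _; rewrite phi0 {1}tE hadamard_powM; apply: phi_pow => //.
      exact: hadamard_pow_nonneg.
    exact: hadamard_pow_defines_operator.
  elim: (index_enum _) => [|p r IH]; first by rewrite !big_nil powR1.
  rewrite !big_cons powRM ?prodr_ge0 //.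
  by rewrite ler_wpM2l ?powR_ge0.
rewrite (_ : s^-1 = t / s * t^-1); last first.
  by rewrite mulrAC mulfV ?mul1r // lt0r_neq0.
rewrite powRrM; apply: ge0_ler_powR; rewrite ?nnegrE ?prodr_ge0 ?powR_ge0 //.
by rewrite invr_ge0 ltW.
Qed.

End HadamardMeans.

Theorem theorem3p6 (R : realType) (k : index_kind) (L : banach_seq_space R k)
    (hL : has_unit_basis L) (m : nat) (hm : (0 < m)%N)
    (A : 'I_m -> imatrix R k)
    (hA0 : forall p, nonneg_matrix (A p))
    (hA : forall p, defines_operator L (A p)) :
  [/\ forall s t : R, 1 <= s -> s <= t -> rho_mean L A t <= rho_mean L A s,
      forall t : R, 1 <= t <= m%:R -> rho L (hadamard_prod A) <= rho_mean L A t,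
      forall s t : R, 1 <= s -> s <= t -> norm_mean L A t <= norm_mean L A s,
      forall t : R, 1 <= t <= m%:R ->
        matrix_norm L (hadamard_prod A) <= norm_mean L A t
    & is_l2 L ->
      matrix_w L (hadamard_prod A) <=
        (\prod_(p < m) matrix_w L (hadamard_pow (A p) m%:R)) `^ m%:R^-1].
Proof.
have A0 p : nonneg_matrix (hadamard_pow (A p) m%:R).
  exact: hadamard_pow_nonneg.
have m1 : 1 <= m%:R :> R by rewrite ler1n.
have Am p : defines_operator L (hadamard_pow (A p) m%:R).
  exact: hadamard_pow_defines_operator.
have rho_decr := hadamard_mean_decreasing hL hA0 hA (rho_ge0 L) (rho_powR hL).
have norm_decr := hadamard_mean_decreasing hL hA0 hA (matrix_norm_ge0 L)
  (matrix_norm_powR hL).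
split=> //; rewrite ?hadamard_prod_gmean //.
(* The mean estimate is the bound at [t = m]; monotonicity carries it to every smaller [t]. *)
- move=> t /andP[t1 tm]; apply: le_trans (rho_decr _ _ t1 tm).
  exact: rho_gmean.
- move=> t /andP[t1 tm]; apply: le_trans (norm_decr _ _ t1 tm).
  exact: matrix_norm_gmean.
- move=> l2L; apply: matrix_w_gmean => //.
  exact: hadamard_gmean_defines_operator.
Qed.
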